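(* Let $\mu\ge 1$, $\nu\ge 0$ and let $(G,X,\Gamma)$ be a $(\mu,\nu)$-path system group. Assume that $G$ contains a constricting element. Let $H$ be an infinite index subgroup of $G$ such that: (I) $\omega_H<\infty$; (II) $H$ is divergent; (III) $H$ is quasi-convex. Then $\omega_H<\omega_G$.
   Context: A path in a metric space $X$ is a rectifiable continuous map $\alpha\colon[a,b]\to X$ parametrised by arc length; it is a $(\kappa,\lambda)$-quasi-geodesic if $d(\alpha(t),\alpha(t'))\le |t-t'|\le \kappa\, d(\alpha(t),\alpha(t'))+\lambda$ for all $t,t'\in[a,b]$. For $Y\subseteq X$, $Y^{+\eta}=\{x\in X: d(x,Y)\le\eta\}$. A $(\mu,\nu)$-path system on a geodesic metric space $X$ is a collection $\Gamma$ of paths of $X$ such that: $\Gamma$ is closed under taking subpaths; any two points of $X$ are joined by some element of $\Gamma$; every element of $\Gamma$ is a $(\mu,\nu)$-quasi-geodesic. A $(\mu,\nu)$-path system group $(G,X,\Gamma)$ is a group $G$ acting properly by isometries on a geodesic metric space $X$ (i.e. $B_G(x,r)=\{g\in G: d(x,gx)\le r\}$ is finite for all $x\in X$, $r\ge0$), together with a $G$-invariant $(\mu,\nu)$-path system $\Gamma$. A subset $Y\subseteq X$ is $\eta$-quasi-convex if every $\gamma\in\Gamma$ with endpoints in $Y$ is contained in $Y^{+\eta}$. A subgroup $H\le G$ is $\eta$-quasi-convex if there is an $H$-invariant $\eta$-quasi-convex subset $Y\subseteq X$ on which $H$ acts $\eta$-coboundedly (for all $y,y'\in Y$ there is $h\in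 H$ with $d(y,hy')\le\eta$); $H$ is quasi-convex if it is $\eta$-quasi-convex for some $\eta\ge0$. A subset $A\subseteq X$ is $\delta$-constricting if there is a map $\pi_A\colon X\to A$ such that (CS1) $d(x,\pi_A(x))\le\delta$ for all $x\in A$, and (CS2) for all $x,y\in X$ and every $\gamma\in\Gamma$ joining $x$ to $y$, if $d(\pi_A(x),\pi_A(y))>\delta$ then $\gamma$ meets both closed balls $B_X(\pi_A(x),\delta)$ and $B_X(\pi_A(y),\delta)$. An element $g\in G$ is $\delta$-constricting if it has infinite order and there is a $\langle g\rangle$-invariant $\delta$-constricting subset $A$ on which $\langle g\rangle$ acts $\delta$-coboundedly; $g$ is constricting if it is $\delta$-constricting for some $\delta\ge0$. For $o\in X$ and $H\le G$, the relative exponential growth rate is $\omega_H=\limsup_{r\to\infty}\frac1r\log|B_G(o,r)\cap H|$ (independent of $o$). The Poincaré series is $\mathcal P_H(s)=\sum_{h\in H}e^{-s\,d(o,ho)}$; $H$ is divergent if $\mathcal P_H(\omega_H)$ diverges. *)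

(* Defs.v *)
From Stdlib Require Import Reals Lra List Sorted.
From Coquelicot Require Import Coquelicot.
Import ListNotations.
Open Scope R_scope.

Definition is_metric {X : Type} (d : X -> X -> R) : Prop :=
  (forall x y, 0 <= d x y) /\ (forall x y, d x y = 0 <-> x = y) /\
  (forall x y, d x y = d y x) /\ (forall x y z, d x z <= d x y + d y z).

Definition geodesic {X : Type} (d : X -> X -> R) : Prop :=
  forall x y, exists c : R -> X, c 0 = x /\ c (d x y) = y /\
    forall s t, 0 <= s <= d x y -> 0 <= t <= d x y -> d (c s) (c t) = Rabs (s - t).

(* A path is a map [p_a, p_b] -> X; only the values on [p_a, p_b] matter. *)
Record path (X : Type) := Path { p_a : R; p_b : R; p_f : R -> X }.
Arguments Path {X}. Arguments p_a {X}. Arguments p_b {X}. Arguments p_f {X}.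

Fixpoint chain_sum {X : Type} (d : X -> X -> R) (f : R -> X) (l : list R) : R :=
  match l with
  | x :: ((y :: _) as l') => d (f x) (f y) + chain_sum d f l'
  | _ => 0
  end.

Definition length_is {X : Type} (d : X -> X -> R) (f : R -> X) (s t L : R) : Prop :=
  (forall l, Sorted Rle (s :: l ++ [t]) -> chain_sum d f (s :: l ++ [t]) <= L) /\
  (forall eps, 0 < eps -> exists l, Sorted Rle (s :: l ++ [t]) /\
                                  L - eps < chain_sum d f (s :: l ++ [t])).

Definition is_path {X : Type} (d : X -> X -> R) (p : path X) : Prop :=
  p_a p <= p_b p /\
  (forall t, p_a p <= t <= p_b p -> forall eps, 0 < eps -> exists del, 0 < del /\
     forall t', p_a p <= t' <= p_b p -> Rabs (t - t') < del -> d (p_f p t) (p_f p t') < eps) /\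
  (forall s t, p_a p <= s -> s <= t -> t <= p_b p -> length_is d (p_f p) s t (t - s)).

Definition quasi_geodesic {X : Type} (d : X -> X -> R) (k l : R) (p : path X) : Prop :=
  forall t t', p_a p <= t <= p_b p -> p_a p <= t' <= p_b p ->
    d (p_f p t) (p_f p t') <= Rabs (t - t') /\
    Rabs (t - t') <= k * d (p_f p t) (p_f p t') + l.

Definition joins {X : Type} (p : path X) (x y : X) : Prop :=
  p_f p (p_a p) = x /\ p_f p (p_b p) = y.

Definition path_system {X : Type} (d : X -> X -> R) (mu nu : R) (Gam : path X -> Prop) : Prop :=
  (forall p, Gam p -> is_path d p) /\
  (forall p a' b', Gam p -> p_a p <= a' -> a' <= b' -> b' <= p_b p ->
     Gam (Path a' b' (p_f p))) /\
  (forall x y, exists p, Gam p /\ joins p x y) /\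
  (forall p, Gam p -> quasi_geodesic d mu nu p).

Definition is_group {G : Type} (mul : G -> G -> G) (one : G) (inv : G -> G) : Prop :=
  (forall a b c, mul a (mul b c) = mul (mul a b) c) /\
  (forall a, mul one a = a /\ mul a one = a) /\
  (forall a, mul (inv a) a = one /\ mul a (inv a) = one).

Definition is_subgroup {G : Type} (mul : G -> G -> G) (one : G) (inv : G -> G)
  (H : G -> Prop) : Prop :=
  H one /\ (forall a b, H a -> H b -> H (mul a b)) /\ (forall a, H a -> H (inv a)).

Definition finite_pred {G : Type} (P : G -> Prop) : Prop :=
  exists l : list G, forall g, P g -> In g l.

Definition infinite_index {G : Type} (mul : G -> G -> G) (inv : G -> G) (H : G -> Prop) : Prop :=
  ~ exists l : list G, forall g, exists gi, In gi l /\ H (mul (inv gi) g).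

Definition proper_isometric_action {G X : Type} (mul : G -> G -> G) (one : G)
  (d : X -> X -> R) (act : G -> X -> X) : Prop :=
  (forall x, act one x = x) /\
  (forall g h x, act (mul g h) x = act g (act h x)) /\
  (forall g x y, d (act g x) (act g y) = d x y) /\
  (forall x r, 0 <= r -> finite_pred (fun g => d x (act g x) <= r)).

Definition invariant_paths {G X : Type} (act : G -> X -> X) (Gam : path X -> Prop) : Prop :=
  forall g p, Gam p -> Gam (Path (p_a p) (p_b p) (fun t => act g (p_f p t))).

Definition path_system_group {G X : Type} (mul : G -> G -> G) (one : G) (inv : G -> G)
  (d : X -> X -> R) (act : G -> X -> X) (Gam : path X -> Prop) (mu nu : R) : Prop :=
  is_group mul one inv /\ is_metric d /\ geodesic d /\
  proper_isometric_action mul one d act /\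
  path_system d mu nu Gam /\ invariant_paths act Gam.

(* x \in Y^{+eta}, i.e. d(x, Y) = inf_{y in Y} d(x,y) <= eta *)
Definition in_nbhd {X : Type} (d : X -> X -> R) (Y : X -> Prop) (eta : R) (x : X) : Prop :=
  forall eps, 0 < eps -> exists y, Y y /\ d x y < eta + eps.

Definition quasi_convex_set {X : Type} (d : X -> X -> R) (Gam : path X -> Prop)
  (eta : R) (Y : X -> Prop) : Prop :=
  forall p, Gam p -> Y (p_f p (p_a p)) -> Y (p_f p (p_b p)) ->
    forall t, p_a p <= t <= p_b p -> in_nbhd d Y eta (p_f p t).

Definition quasi_convex_subgroup {G X : Type} (d : X -> X -> R) (act : G -> X -> X)
  (Gam : path X -> Prop) (H : G -> Prop) : Prop :=
  exists eta, 0 <= eta /\ exists Y : X -> Prop,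
    (exists y, Y y) /\
    (forall h y, H h -> Y y -> Y (act h y)) /\
    quasi_convex_set d Gam eta Y /\
    (forall y y', Y y -> Y y' -> exists h, H h /\ d y (act h y') <= eta).

Fixpoint gpow {G : Type} (mul : G -> G -> G) (one : G) (g : G) (n : nat) : G :=
  match n with O => one | S n' => mul g (gpow mul one g n') end.

Definition in_cyclic {G : Type} (mul : G -> G -> G) (one : G) (inv : G -> G) (g k : G) : Prop :=
  exists n : nat, k = gpow mul one g n \/ k = gpow mul one (inv g) n.

Definition constricting_set {X : Type} (d : X -> X -> R) (Gam : path X -> Prop)
  (delta : R) (A : X -> Prop) : Prop :=
  exists piA : X -> X, (forall x, A (piA x)) /\
    (forall x, A x -> d x (piA x) <= delta) /\
    (forall x y p, Gam p -> joins p x y -> d (piA x) (piA y) > delta ->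
       (exists t, p_a p <= t <= p_b p /\ d (p_f p t) (piA x) <= delta) /\
       (exists t, p_a p <= t <= p_b p /\ d (p_f p t) (piA y) <= delta)).

Definition constricting_element {G X : Type} (mul : G -> G -> G) (one : G) (inv : G -> G)
  (d : X -> X -> R) (act : G -> X -> X) (Gam : path X -> Prop) (g : G) : Prop :=
  (forall n : nat, (1 <= n)%nat -> gpow mul one g n <> one) /\
  exists delta, 0 <= delta /\ exists A : X -> Prop,
    (forall k x, in_cyclic mul one inv g k -> A x -> A (act k x)) /\
    constricting_set d Gam delta A /\
    (forall a a', A a -> A a' -> exists k, in_cyclic mul one inv g k /\ d a (act k a') <= delta).

Definition card_is {G : Type} (P : G -> Prop) (n : nat) : Prop :=
  exists l : list G, NoDup l /\ (forall g, In g l <-> P g) /\ length l = n.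

(* omega_H = limsup_{r -> oo} (1/r) log |B_G(o,r) \cap H|
           = inf_{R0} sup_{r >= R0, r > 0} (1/r) log |B_G(o,r) \cap H| *)
Definition growth_rate {G X : Type} (d : X -> X -> R) (act : G -> X -> X) (o : X)
  (H : G -> Prop) : Rbar :=
  Rbar_glb (fun z => exists R0 : R, z = Rbar_lub (fun y => exists r n, R0 <= r /\ 0 < r /\
     card_is (fun g => H g /\ d o (act g o) <= r) n /\ y = Finite (ln (INR n) / r))).

Fixpoint sum_list (l : list R) : R := match l with [] => 0 | x :: l' => x + sum_list l' end.

Definition poincare_diverges {G X : Type} (d : X -> X -> R) (act : G -> X -> X) (o : X)
  (H : G -> Prop) (s : R) : Prop :=
  forall M : R, exists l : list G, NoDup l /\ (forall h, In h l -> H h) /\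
    M < sum_list (map (fun h => exp (- s * d o (act h o))) l).

Definition divergent {G X : Type} (d : X -> X -> R) (act : G -> X -> X) (o : X)
  (H : G -> Prop) : Prop :=
  poincare_diverges d act o H (real (growth_rate d act o H)).

(* Main.v *)
(** The growth gap comes from a family of words that behaves like a free monoid
    inside [G]. Let [P] be the constricting projection to the axis [A] of a constricting element
    [g], and [H y0] a quasi-convex orbit.

    First, some translate [k H y0] has bounded projection to [A]. Otherwise, for every [k],
    a path joining two points of [k H y0] follows [A] for a long time, so that by pigeonhole
    a power [g^m], taken from a finite set not depending on [k], lies in [k H k^-1]; then [A] is
    uniformly close to [k H y0] for all [k], and [H] has finite index.

    After conjugating, the projection of [H y0] itself is bounded. If [u] is a large power of [g],
    the elements [h1 u h2 u ... hn u] are pairwise distinct when the [hi] range over a subset [F]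
    of [H] that is sufficiently separated. As [H] is divergent, a finite such [F] can be chosen with
    [sum_{h in F} exp(- s (d(o,ho) + d(o,uo))) >= 2] for some [s > omega_H]; hence the words of length
    [n] have weight at least [2^n], whereas it would be at most linear in [n] if [omega_G < s]. *)

Require Import Defs.
From Stdlib Require Import Reals Lra Lia List ZArith Classical FinFun.
From Coquelicot Require Import Coquelicot.
Import ListNotations.
Open Scope R_scope.

(** * Coarse geometry of constricting projections *)

(** (CS1) is recorded only as near-idempotence of [P], so that the notion mentions no target set and
    passes directly to conjugates of [P] by isometries. *)
Definition constricting_map {X : Type} (d : X -> X -> R) (Gam : path X -> Prop)
  (delta : R) (P : X -> X) : Prop :=
  (forall x, d (P x) (P (P x)) <= delta) /\
  (forall x y p, Gam p -> joins p x y -> d (P x) (P y) > delta ->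
     (exists t, p_a p <= t <= p_b p /\ d (p_f p t) (P x) <= delta) /\
     (exists t, p_a p <= t <= p_b p /\ d (p_f p t) (P y) <= delta)).

Section Paths.
Context {X : Type} (d : X -> X -> R) (Gam : path X -> Prop) (mu nu : R).
Context (Hmu : 1 <= mu) (Hnu : 0 <= nu) (Hd : is_metric d) (HG : path_system d mu nu Gam).

Lemma metric_nonneg x y : 0 <= d x y.
Proof. apply Hd. Qed.

Lemma metric_refl x : d x x = 0.
Proof. destruct Hd as (_ & Hd0 & _). now apply Hd0. Qed.

Lemma metric_sym x y : d x y = d y x.
Proof. apply Hd. Qed.

Lemma metric_triangle x y z : d x z <= d x y + d y z.
Proof. apply Hd. Qed.

Lemma path_dist_le p s t : Gam p -> p_a p <= s <= p_b p -> p_a p <= t <= p_b p ->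
  d (p_f p s) (p_f p t) <= Rabs (s - t).
Proof.
intros Hp Hs Ht. destruct HG as (_ & _ & _ & Hqg). now apply (Hqg p Hp s t).
Qed.

Lemma path_time_le p s t c : Gam p -> p_a p <= s <= p_b p -> p_a p <= t <= p_b p ->
  d (p_f p s) (p_f p t) <= c -> Rabs (s - t) <= mu * c + nu.
Proof.
intros Hp Hs Ht Hc. destruct HG as (_ & _ & _ & Hqg).
destruct (Hqg p Hp s t Hs Ht) as [_ Hl].
assert (mu * d (p_f p s) (p_f p t) <= mu * c) by (apply Rmult_le_compat_l; lra).
lra.
Qed.

Lemma path_between x y : exists p, Gam p /\ p_a p <= p_b p /\
  p_f p (p_a p) = x /\ p_f p (p_b p) = y.
Proof.
destruct HG as (Hip & _ & Hj & _). destruct (Hj x y) as (p & Hp & H1 & H2).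
exists p. repeat split; auto. now apply Hip.
Qed.

Lemma subpath p s t : Gam p -> p_a p <= s -> s <= t -> t <= p_b p ->
  Gam (Path s t (p_f p)).
Proof. intros. destruct HG as (_ & Hs & _). now apply Hs. Qed.

Section Projection.
Context (delta : R) (P : X -> X) (Hdelta : 0 <= delta).
Context (HP : constricting_map d Gam delta P).

(** (CS2) is applied to the subpath between the two times. They may come in either order, so the
    point near the projection of [p_f p s] can be sought both forwards and backwards from [s]. *)
Lemma constricting_between p s t : Gam p -> p_a p <= s <= p_b p -> p_a p <= t <= p_b p ->
  d (P (p_f p s)) (P (p_f p t)) > delta ->
  exists r, Rmin s t <= r <= Rmax s t /\ d (p_f p r) (P (p_f p s)) <= delta.
Proof.
intros Hp Hs Ht Hlt. destruct HP as [_ H2].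
destruct (Rle_dec s t) as [Hst|Hst].
- destruct (H2 (p_f p s) (p_f p t) (Path s t (p_f p))) as [(r & Hr & Hr') _]; auto.
  + apply subpath; auto; lra.
  + split; reflexivity.
  + exists r. rewrite Rmin_left, Rmax_right by lra. auto.
- destruct (H2 (p_f p t) (p_f p s) (Path t s (p_f p))) as [_ (r & Hr & Hr')]; auto.
  + apply subpath; auto; lra.
  + split; reflexivity.
  + rewrite metric_sym. exact Hlt.
  + exists r. rewrite Rmin_right, Rmax_left by lra. auto.
Qed.

(** If the projections are more than [delta] apart, a path from [x] to [y] passes within [delta] of
    both, and its length is at most [mu * c + nu]. *)
Lemma constricting_lipschitz x y c : d x y <= c -> d (P x) (P y) <= 2 * delta + mu * c + nu.
Proof.
intros Hc. assert (H0 := metric_nonneg x y).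
assert (0 <= mu * c) by (apply Rmult_le_pos; lra).
destruct (Rle_dec (d (P x) (P y)) delta) as [Hle|Hgt]; [lra|].
destruct (path_between x y) as (p & Hp & Hab & <- & <-).
destruct (proj2 HP _ _ p Hp (conj eq_refl eq_refl)) as [(r & Hr & Hr') (s & Hs & Hs')]; [lra|].
assert (Hl := path_time_le p (p_a p) (p_b p) c Hp ltac:(lra) ltac:(lra) Hc).
assert (Hrs := path_dist_le p r s Hp Hr Hs).
rewrite (Rabs_minus_sym (p_a p)), Rabs_pos_eq in Hl by lra.
assert (Rabs (r - s) <= p_b p - p_a p) by (apply Rabs_le; lra).
set (x' := P (p_f p (p_a p))) in *. set (y' := P (p_f p (p_b p))) in *.
assert (T1 := metric_triangle x' (p_f p r) y').
assert (T2 := metric_triangle (p_f p r) (p_f p s) y').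
rewrite (metric_sym x' (p_f p r)) in T1. lra.
Qed.

End Projection.

(** Suppose [P x] and [Q x] are far apart. A path from [x] to [Q x] first has to pass near [P x];
    before that it has already been near [Q x], because the point near [P x] has its [Q]-projection
    far from [Q x]. Returning near its own endpoint, the quasi-geodesic has little time left, so
    [P x] is close to [Q x] after all. *)
Lemma constricting_maps_close delta P Q x : 0 <= delta ->
  constricting_map d Gam delta P -> constricting_map d Gam delta Q ->
  (forall x, d (P (Q x)) (Q x) <= delta) -> (forall x, d (Q (P x)) (P x) <= delta) ->
  d (P x) (Q x) <= 4 * delta + mu * delta + nu.
Proof.
intros Hdelta HP HQ HPQ HQP.
assert (Hmd : 0 <= mu * delta) by (apply Rmult_le_pos; lra).
apply Rnot_lt_le; intros Hlt.
destruct (path_between x (Q x)) as (p & Hp & Hab & Ha & Hb).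
assert (T1 := metric_triangle (P x) (P (Q x)) (Q x)). specialize (HPQ x).
destruct (constricting_between delta P HP p (p_a p) (p_b p)) as (s & Hs & Hs'); try lra; auto.
{ rewrite Ha, Hb. lra. }
rewrite Rmin_left, Rmax_right in Hs by lra. rewrite Ha in Hs'.
assert (HL := constricting_lipschitz delta Q Hdelta HQ _ _ _ Hs').
assert (T2 := metric_triangle (P x) (Q (P x)) (Q x)).
assert (T3 := metric_triangle (Q (P x)) (Q (p_f p s)) (Q x)).
specialize (HQP x). rewrite (metric_sym (P x) (Q (P x))) in T2.
rewrite (metric_sym (Q (P x)) (Q (p_f p s))) in T3.
(* The bound [4 * delta + mu * delta + nu] exceeds by [delta] the distance lost on the way from
   [P x] to [Q (p_f p s)], which is what (CS2) for [Q] requires. *)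
destruct (constricting_between delta Q HQ p (p_a p) s) as (s' & Hs1 & Hs2); try lra; auto.
{ rewrite Ha. rewrite (metric_sym (Q x)). lra. }
rewrite Rmin_left, Rmax_right in Hs1 by lra. rewrite Ha in Hs2.
rewrite <- Hb in Hs2.
assert (Ht := path_time_le p s' (p_b p) delta Hp ltac:(lra) ltac:(lra) Hs2).
rewrite Rabs_minus_sym, Rabs_pos_eq in Ht by lra.
assert (Hd1 := path_dist_le p s (p_b p) Hp ltac:(lra) ltac:(lra)).
rewrite Rabs_minus_sym, Rabs_pos_eq in Hd1 by lra. rewrite Hb in Hd1.
assert (T4 := metric_triangle (P x) (p_f p s) (Q x)).
rewrite (metric_sym (P x) (p_f p s)) in T4. lra.
Qed.

End Paths.

(** * Words and elementary group identities *)

Fixpoint word {G : Type} (mul : G -> G -> G) (one u : G) (l : list G) : G :=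
  match l with
  | [] => one
  | h :: l' => mul h (mul u (word mul one u l'))
  end.

Section Group.
Context {G : Type} (mul : G -> G -> G) (one : G) (inv : G -> G).
Context (Hg : is_group mul one inv).

Lemma gmulA a b c : mul a (mul b c) = mul (mul a b) c.
Proof. apply Hg. Qed.

Lemma gmul1l a : mul one a = a.
Proof. apply Hg. Qed.

Lemma gmul1r a : mul a one = a.
Proof. apply Hg. Qed.

Lemma gmulVl a : mul (inv a) a = one.
Proof. apply Hg. Qed.

Lemma gmulVr a : mul a (inv a) = one.
Proof. apply Hg. Qed.

Lemma gmulKl a b : mul (inv a) (mul a b) = b.
Proof. now rewrite gmulA, gmulVl, gmul1l. Qed.

Lemma gmulKVl a b : mul a (mul (inv a) b) = b.
Proof. now rewrite gmulA, gmulVr, gmul1l. Qed.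

Lemma gmul_cancel_l a b c : mul a b = mul a c -> b = c.
Proof. intros E. rewrite <- (gmulKl a b), E. apply gmulKl. Qed.

Lemma ginv_unique a b : mul a b = one -> b = inv a.
Proof. intros E. now rewrite <- (gmulKl a b), E, gmul1r. Qed.

Lemma ginvM a b : inv (mul a b) = mul (inv b) (inv a).
Proof.
symmetry. apply ginv_unique.
now rewrite <- gmulA, (gmulA b), gmulVr, gmul1l, gmulVr.
Qed.

Lemma ginvK a : inv (inv a) = a.
Proof. symmetry. apply ginv_unique, gmulVl. Qed.

End Group.

(** * The isometric action on the space and on its paths *)

Section Action.
Context {G X : Type} (mul : G -> G -> G) (one : G) (inv : G -> G).
Context (d : X -> X -> R) (act : G -> X -> X) (Gam : path X -> Prop) (mu nu : R).
Context (Hmu : 1 <= mu) (Hnu : 0 <= nu).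
Context (HGX : path_system_group mul one inv d act Gam mu nu).

Let Hg : is_group mul one inv. Proof. apply HGX. Qed.
Let Hd : is_metric d. Proof. apply HGX. Qed.
Let HG : path_system d mu nu Gam. Proof. apply HGX. Qed.
Let Ha : proper_isometric_action mul one d act. Proof. apply HGX. Qed.
Let Hi : invariant_paths act Gam. Proof. apply HGX. Qed.

Lemma act1 x : act one x = x.
Proof. apply Ha. Qed.

Lemma actM g h x : act (mul g h) x = act g (act h x).
Proof. apply Ha. Qed.

Lemma act_dist g x y : d (act g x) (act g y) = d x y.
Proof. apply Ha. Qed.

Lemma actK g x : act (inv g) (act g x) = x.
Proof. now rewrite <- actM, (gmulVl _ _ _ Hg), act1. Qed.

Lemma actVK g x : act g (act (inv g) x) = x.
Proof. now rewrite <- actM, (gmulVr _ _ _ Hg), act1. Qed.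

Lemma act_dist_inv g x y : d (act g x) y = d x (act (inv g) y).
Proof. now rewrite <- (act_dist (inv g)), actK. Qed.

(** Properness compares a point with its own translates; replacing [y] by [x] enlarges the radius by
    [d x y]. *)
Lemma act_finite x y r : finite_pred (fun g => d x (act g y) <= r).
Proof.
destruct Ha as (_ & _ & _ & Hprop).
destruct (Rle_dec 0 (r + d x y)) as [Hr|Hr].
- destruct (Hprop x _ Hr) as [l Hl]. exists l. intros g Hgr. apply Hl.
  assert (T := metric_triangle d Hd x (act g y) (act g x)).
  rewrite act_dist in T. rewrite (metric_sym d Hd y x) in T. lra.
- exists []. intros g Hgr. exfalso.
  assert (T := metric_nonneg d Hd x (act g y)). assert (T' := metric_nonneg d Hd x y). lra.
Qed.

Lemma constricting_map_conj delta P g : constricting_map d Gam delta P ->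
  constricting_map d Gam delta (fun x => act g (P (act (inv g) x))).
Proof.
intros [H1 H2]. split.
- intros x. rewrite actK, act_dist. apply H1.
- intros x y p Hp [Hx Hy] Hlt. rewrite act_dist in Hlt.
  destruct (H2 (act (inv g) x) (act (inv g) y) (Path (p_a p) (p_b p) (fun t => act (inv g) (p_f p t))) (Hi _ _ Hp))
    as [(t & Ht & Ht') (s & Hs & Hs')]; [|exact Hlt|].
  { split; cbn; [now rewrite Hx | now rewrite Hy]. }
  cbn in Ht, Ht', Hs, Hs'. split; [exists t | exists s]; (split; [assumption|]).
  + rewrite <- (act_dist (inv g)), actK. assumption.
  + rewrite <- (act_dist (inv g)), actK. assumption.
Qed.

(** * Free behaviour of words under a bounded projection of the orbit of [H] *)

Section Words.
Context (delta : R) (P : X -> X) (Hdelta : 0 <= delta).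
Context (HP : constricting_map d Gam delta P).
Context (H : G -> Prop) (HH : is_subgroup mul one inv H).
Context (y0 : X) (D K0 : R) (HD : forall h, H h -> d (P (act h y0)) (P y0) <= D) (HK0 : 0 <= K0).

Let a0 := P y0.
(** Radius around [a0] for the projections of words: [D] accounts for the orbit [H y0], and [delta]
    is the margin that triggers (CS2). *)
Let E := D + delta.
Let lip c := 2 * delta + mu * c + nu.

(* A path from [h y0] to [v y0] passes near [h u a0] and near [a0]. Both the start of the path
   and its point near [a0] project to [h A] near [h a0]; as [h u a0] is far away, the piece of path
   between those two points returns to [h a0], which the quasi-geodesic can only do early on.
   Hence one of the two points is close to [h a0]; it must be [a0]. *)
Lemma diverging_projections : exists C1 R1, 0 <= C1 /\ forall u h v, R1 < d a0 (act u a0) ->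
  (forall x, d (P (act u x)) (act u (P x)) <= K0) -> H h ->
  d (act h (P (act (inv h) (act v y0)))) (act h (act u a0)) <= E + K0 ->
  E < d (P (act v y0)) a0 -> d a0 (act h a0) <= C1.
Proof.
destruct HH as (Hone & HM & HV).
assert (HD0 : 0 <= D).
{ assert (T := HD one Hone). rewrite act1, (metric_refl d Hd) in T. exact T. }
pose (L := d a0 y0). assert (HL : 0 <= L) by apply (metric_nonneg d Hd).
(* [K1] and [K2] bound how far the conjugate projection [Q] moves the path point near [a0] from
   [act h a0], and the one near [act h (act u a0)] from that point. [T] bounds the time at which the
   path can still be near [act h a0]. *)
pose (K1 := lip (delta + D + L) + D).
pose (K2 := lip (delta + E + K0) + K0 + delta).
pose (T := mu * (delta + K1 + L) + nu).
assert (HE : 0 <= E) by (unfold E; lra).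
assert (H1 : 0 <= K1).
{ unfold K1, lip. assert (0 <= mu * (delta + D + L)) by (apply Rmult_le_pos; lra). lra. }
assert (H2 : 0 <= K2).
{ unfold K2, lip. assert (0 <= mu * (delta + E + K0)) by (apply Rmult_le_pos; lra). lra. }
assert (HT : 0 <= T).
{ unfold T. assert (0 <= mu * (delta + K1 + L)) by (apply Rmult_le_pos; lra). lra. }
exists (delta + D + T + L), (K1 + K2 + 2 * delta + E + K0 + T + L).
split; [lra|]. intros u h v Hu Hequ Hh Hv1 Hv2.
set (Q := fun x => act h (P (act (inv h) x))) in *.
assert (HQ : constricting_map d Gam delta Q) by now apply constricting_map_conj.
change (act h (P (act (inv h) (act v y0)))) with (Q (act v y0)) in Hv1.
assert (dtri := metric_triangle d Hd). assert (dsym := metric_sym d Hd).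
destruct (path_between d Gam mu nu HG (act h y0) (act v y0)) as (p & Hp & Hab & Hpa & Hpb).
destruct (constricting_between d Gam mu nu Hd HG delta P HP p (p_a p) (p_b p))
  as (t2 & Ht2 & Ht2'); try lra; auto.
{ rewrite Hpa, Hpb. specialize (HD h Hh). fold a0 in HD.
  assert (T1 := dtri (P (act v y0)) (P (act h y0)) a0).
  rewrite (dsym (P (act v y0)) (P (act h y0))) in T1. unfold E in *. lra. }
rewrite Rmin_left, Rmax_right in Ht2 by lra. rewrite Hpa in Ht2'.
assert (Hx2 : d (p_f p t2) a0 <= delta + D).
{ assert (T1 := dtri (p_f p t2) (P (act h y0)) a0). specialize (HD h Hh). fold a0 in HD. lra. }
assert (HQh : Q (act h y0) = act h a0) by (unfold Q; now rewrite actK).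
destruct (proj2 HQ _ _ p Hp (conj Hpa Hpb)) as [_ (t1 & Ht1 & Ht1')].
{ rewrite HQh. assert (T1 := dtri (act h a0) (Q (act v y0)) (act h (act u a0))).
  rewrite act_dist in T1. lra. }
assert (Hx1 : d (p_f p t1) (act h (act u a0)) <= delta + E + K0).
{ assert (T1 := dtri (p_f p t1) (Q (act v y0)) (act h (act u a0))). lra. }
assert (HQ2 : d (Q (p_f p t2)) (act h a0) <= K1).
{ assert (T1 := dtri (p_f p t2) a0 y0). fold L in T1.
  assert (T2 := constricting_lipschitz d Gam mu nu Hmu Hnu Hd HG delta Q Hdelta HQ (p_f p t2) y0
                  (delta + D + L) ltac:(lra)).
  assert (T3 := dtri (Q (p_f p t2)) (Q y0) (act h a0)).
  assert (T4 : d (Q y0) (act h a0) <= D).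
  { unfold Q. rewrite act_dist. now apply HD, HV. }
  unfold K1, lip. lra. }
assert (HQ1 : d (Q (p_f p t1)) (act h (act u a0)) <= K2).
{ assert (T2 := constricting_lipschitz d Gam mu nu Hmu Hnu Hd HG delta Q Hdelta HQ _ _ _ Hx1).
  assert (T3 := dtri (Q (p_f p t1)) (Q (act h (act u a0))) (act h (act u a0))).
  assert (T4 : d (Q (act h (act u a0))) (act h (act u a0)) <= K0 + delta).
  { unfold Q. rewrite actK, act_dist.
    assert (T5 := dtri (P (act u a0)) (act u (P a0)) (act u a0)).
    rewrite act_dist in T5. specialize (Hequ a0). assert (T6 := proj1 HP y0). fold a0 in T6.
    rewrite (dsym (P a0)) in T5. lra. }
  unfold K2, lip. lra. }
assert (Hua : d (act h a0) (act h (act u a0)) = d a0 (act u a0)) by apply act_dist.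
destruct (constricting_between d Gam mu nu Hd HG delta Q HQ p t2 t1)
  as (t4 & Ht4 & Ht4'); try lra; auto.
{ assert (T1 := dtri (act h a0) (Q (p_f p t2)) (act h (act u a0))).
  assert (T2 := dtri (Q (p_f p t2)) (Q (p_f p t1)) (act h (act u a0))).
  rewrite (dsym (act h a0) (Q (p_f p t2))) in T1. lra. }
assert (Ht4a : p_a p <= t4 <= p_b p).
{ unfold Rmin, Rmax in Ht4. destruct (Rle_dec t2 t1); lra. }
assert (Hstart : d (act h y0) (act h a0) = L).
{ unfold L. rewrite act_dist. apply dsym. }
assert (Hx4 : d (p_f p t4) (p_f p (p_a p)) <= delta + K1 + L).
{ rewrite Hpa. assert (T1 := dtri (p_f p t4) (Q (p_f p t2)) (act h y0)).
  assert (T2 := dtri (Q (p_f p t2)) (act h a0) (act h y0)).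
  rewrite (dsym (act h a0) (act h y0)) in T2. lra. }
assert (Ht4T := path_time_le d Gam mu nu Hmu HG p t4 (p_a p) _ Hp Ht4a ltac:(lra) Hx4).
fold T in Ht4T. rewrite Rabs_pos_eq in Ht4T by lra.
assert (Hend : forall t, p_a p <= t <= p_b p -> t <= t4 -> d (p_f p t) (act h a0) <= T + L).
{ intros t Ht Htt. assert (T1 := path_dist_le d Gam mu nu HG p t (p_a p) Hp Ht ltac:(lra)).
  rewrite Rabs_pos_eq in T1 by lra. rewrite Hpa in T1.
  assert (T2 := dtri (p_f p t) (act h y0) (act h a0)). lra. }
destruct (Rle_dec t2 t4) as [Hle|Hgt].
- specialize (Hend t2 Ht2 Hle). assert (T1 := dtri a0 (p_f p t2) (act h a0)).
  rewrite (dsym a0 (p_f p t2)) in T1. lra.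
- exfalso. assert (Hle : t1 <= t4).
  { unfold Rmin, Rmax in Ht4. destruct (Rle_dec t2 t1); lra. }
  specialize (Hend t1 Ht1 Hle).
  assert (T1 := dtri (act h a0) (p_f p t1) (act h (act u a0))).
  rewrite (dsym (act h a0) (p_f p t1)) in T1. lra.
Qed.

(** The lemma [diverging_projections] is used twice: once to keep the projections of all words near
    [a0], and once on the quotient of two different first letters of equal words, where it
    contradicts the separation of [F]. *)
Lemma words_free : exists C1 R1, 0 <= C1 /\ forall u, R1 < d a0 (act u a0) ->
  (forall x, d (P (act u x)) (act u (P x)) <= K0) ->
  forall F : G -> Prop, (forall h, F h -> H h /\ C1 < d a0 (act h a0)) ->
  (forall h h', F h -> F h' -> h <> h' -> C1 < d (act h a0) (act h' a0)) ->
  forall l l', List.Forall F l -> List.Forall F l' -> length l = length l' ->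
  word mul one u l = word mul one u l' -> l = l'.
Proof.
destruct diverging_projections as (C1 & R1 & HC1 & Hdiv).
assert (HE : 0 <= E).
{ assert (T := HD one (proj1 HH)). rewrite act1, (metric_refl d Hd) in T. unfold E. lra. }
assert (dtri := metric_triangle d Hd). assert (dsym := metric_sym d Hd).
(* The term [2 * E + K0] ensures that a point projecting within [E + K0] of [act u a0] projects
   further than [E] from [a0]. *)
exists C1, (Rmax R1 (2 * E + K0)). split; [exact HC1|].
intros u Hu Hequ F HF Hsep.
assert (Hu1 := Rmax_l R1 (2 * E + K0)). assert (Hu2 := Rmax_r R1 (2 * E + K0)).
assert (near : forall l, d (P (act (word mul one u l) y0)) a0 <= E ->
  d (P (act (mul u (word mul one u l)) y0)) (act u a0) <= E + K0).
{ intros l Hl. rewrite actM. set (x := act (word mul one u l) y0) in *.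
  assert (T1 := dtri (P (act u x)) (act u (P x)) (act u a0)). rewrite act_dist in T1.
  specialize (Hequ x). lra. }
(* Induction on the word: if the tail projects near [a0] but the whole word does not, then
   [act h a0] is within [C1] of [a0], which the choice of [F] excludes. *)
assert (Hproj : forall l, List.Forall F l -> d (P (act (word mul one u l) y0)) a0 <= E).
{ intros l Hl. induction Hl as [|h l Hh Hl IH].
  - cbn. rewrite act1. fold a0. rewrite (metric_refl d Hd). exact HE.
  - apply Rnot_lt_le; intros Hlt. cbn [word] in Hlt. destruct (HF h Hh) as [HHh Hfar].
    assert (Hc : d a0 (act h a0) <= C1); [|lra].
    apply (Hdiv u h (mul h (mul u (word mul one u l)))); auto; [lra|].
    rewrite (actM h), actK, act_dist. now apply near. }
induction l as [|h l IH]; intros [|h' l'] Hl Hl' Hlen Heq; try discriminate Hlen; [reflexivity|].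
inversion_clear Hl as [|? ? Hh Hl0]. inversion_clear Hl' as [|? ? Hh' Hl0'].
cbn [word] in Heq. injection Hlen as Hlen.
destruct (classic (h = h')) as [<-|Hne].
- f_equal. apply IH; auto.
  now apply (gmul_cancel_l _ _ _ Hg h), (gmul_cancel_l _ _ _ Hg u) in Heq.
(* With [v] the product of [u] and the second tail, multiplying [v] by the inverse of [h'^-1 h]
   gives [u] times the first tail. Both project near [act u a0], so [diverging_projections] applies
   to [h'^-1 h]. *)
- exfalso. destruct (HF h Hh) as [HHh _], (HF h' Hh') as [HHh' _].
  specialize (Hsep h' h Hh' Hh (fun e => Hne (eq_sym e))).
  assert (Hc : d a0 (act (mul (inv h') h) a0) <= C1).
  2: { rewrite actM in Hc. rewrite act_dist_inv, dsym in Hsep.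
       rewrite dsym in Hsep. lra. }
  apply (Hdiv u _ (mul u (word mul one u l'))); auto; [lra| | |].
  + apply HH; [now apply HH|exact HHh].
  + rewrite act_dist, <- actM, (ginvM _ _ _ Hg), (ginvK _ _ _ Hg).
    rewrite <- (gmulA _ _ _ Hg), <- Heq, (gmulKl _ _ _ Hg). apply near; auto.
  + assert (T1 := near l' (Hproj l' Hl0')).
    set (q := P (act (mul u (word mul one u l')) y0)) in *.
    assert (T2 := dtri a0 q (act u a0)). rewrite (dsym a0 q) in T2. lra.
Qed.

End Words.
End Action.

(** * Uniform bounds over lists and a pigeonhole principle *)

Lemma list_uniform_bound {T : Type} (Q : T -> R -> Prop) (l : list T) :
  (forall x C C', Q x C -> C <= C' -> Q x C') ->
  (forall x, In x l -> exists C, Q x C) -> exists C, forall x, In x l -> Q x C.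
Proof.
intros Hmono. induction l as [|a l IH]; intros Hl.
- exists 0. intros x [].
- destruct IH as [C HC]; [intros x Hx; apply Hl; now right|].
  destruct (Hl a (or_introl eq_refl)) as [C' HC'].
  exists (Rmax C C'). intros x [<-|Hx].
  + now apply (Hmono _ C'), Rmax_r.
  + now apply (Hmono _ C), Rmax_l; apply HC.
Qed.

(** The relation may offer several values for each index; finitely many choices, made by induction,
    yield a function from [length B + 1] indices into [B], which cannot be injective. *)
Lemma relational_pigeonhole {T : Type} (Rel : nat -> T -> Prop) (B : list T) :
  (forall i, (i <= length B)%nat -> exists b, In b B /\ Rel i b) ->
  exists i j b, (i < j <= length B)%nat /\ Rel i b /\ Rel j b.
Proof.
intros HB.
assert (Hf : forall n, (n <= S (length B))%nat ->
  exists f : nat -> T, forall i, (i < n)%nat -> In (f i) B /\ Rel i (f i)).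
{ induction n as [|n IH]; intros Hn.
  - destruct (HB 0%nat ltac:(lia)) as [b _]. exists (fun _ => b). intros i Hi. lia.
  - destruct IH as [f Hf]; [lia|]. destruct (HB n ltac:(lia)) as [b Hb].
    exists (fun i => if Nat.eq_dec i n then b else f i). intros i Hi.
    destruct (Nat.eq_dec i n) as [->|Hne]; [exact Hb|apply Hf; lia]. }
destruct (Hf _ (le_n _)) as [f Hf'].
apply NNPP. intros Hno.
assert (Hnd : NoDup (map f (seq 0 (S (length B))))).
{ apply Injective_map_NoDup_in; [|apply seq_NoDup]. intros x y Hx Hy Hxy.
  apply in_seq in Hx, Hy. destruct (Nat.lt_trichotomy x y) as [Hlt|[Heq|Hlt]]; [|exact Heq|].
  - exfalso. apply Hno. exists x, y, (f x). split; [lia|].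
    split; [apply Hf'; lia|rewrite Hxy; apply Hf'; lia].
  - exfalso. apply Hno. exists y, x, (f x). split; [lia|].
    split; [rewrite Hxy; apply Hf'; lia|apply Hf'; lia]. }
apply NoDup_incl_length with (l' := B) in Hnd.
- rewrite length_map, length_seq in Hnd. lia.
- intros x Hx. apply in_map_iff in Hx as (i & <- & Hi). apply in_seq in Hi. apply Hf'. lia.
Qed.

(** * Integer powers of an element of infinite order *)

Section Powers.
Context {G : Type} (mul : G -> G -> G) (one : G) (inv : G -> G) (Hg : is_group mul one inv).
Context (g : G).

(** At least one of the two natural exponents is zero, so this is the power with integer exponent
    [n], written with the two kinds of powers that occur in [in_cyclic]. *)
Definition zpow (n : Z) : G :=
  mul (gpow mul one g (Z.to_nat n)) (gpow mul one (inv g) (Z.to_nat (- n))).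

Lemma zpow_0 : zpow 0 = one.
Proof. apply (gmul1l _ _ _ Hg). Qed.

Lemma zpow_succ n : zpow (Z.succ n) = mul g (zpow n).
Proof.
unfold zpow. destruct (Z_le_gt_dec 0 n) as [Hn|Hn].
- replace (Z.to_nat (- n)) with 0%nat by lia. replace (Z.to_nat (- Z.succ n)) with 0%nat by lia.
  rewrite Z2Nat.inj_succ by exact Hn. cbn. now rewrite <- (gmulA _ _ _ Hg).
- replace (Z.to_nat n) with 0%nat by lia. replace (Z.to_nat (Z.succ n)) with 0%nat by lia.
  replace (Z.to_nat (- n)) with (S (Z.to_nat (- Z.succ n))) by lia. cbn.
  now rewrite !(gmul1l _ _ _ Hg), (gmulKVl _ _ _ Hg).
Qed.

Lemma zpow_add m n : zpow (m + n) = mul (zpow m) (zpow n).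
Proof.
induction m as [|m IH|m IH] using Z.peano_ind.
- now rewrite zpow_0, (gmul1l _ _ _ Hg).
- now rewrite Z.add_succ_l, !zpow_succ, IH, (gmulA _ _ _ Hg).
- apply (gmul_cancel_l _ _ _ Hg g). rewrite (gmulA _ _ _ Hg), <- !zpow_succ.
  now rewrite <- Z.add_succ_l, Z.succ_pred.
Qed.

Lemma zpow_opp n : zpow (- n) = inv (zpow n).
Proof.
apply (ginv_unique _ _ _ Hg). now rewrite <- zpow_add, Z.add_opp_diag_r, zpow_0.
Qed.

Lemma in_cyclic_zpow k : in_cyclic mul one inv g k <-> exists n, k = zpow n.
Proof.
split.
- intros (n & [-> | ->]).
  + exists (Z.of_nat n). unfold zpow. rewrite Nat2Z.id.
    replace (Z.to_nat (- Z.of_nat n)) with 0%nat by lia. symmetry. apply (gmul1r _ _ _ Hg).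
  + exists (- Z.of_nat n)%Z. unfold zpow. rewrite Z.opp_involutive, Nat2Z.id.
    replace (Z.to_nat (- Z.of_nat n)) with 0%nat by lia. symmetry. apply (gmul1l _ _ _ Hg).
- intros (n & ->). unfold zpow. destruct (Z_le_gt_dec 0 n) as [Hn|Hn].
  + exists (Z.to_nat n). left. replace (Z.to_nat (- n)) with 0%nat by lia. apply (gmul1r _ _ _ Hg).
  + exists (Z.to_nat (- n)). right. replace (Z.to_nat n) with 0%nat by lia. apply (gmul1l _ _ _ Hg).
Qed.

Context (Hinf : forall n : nat, (1 <= n)%nat -> gpow mul one g n <> one).

Lemma zpow_eq_one n : zpow n = one -> n = 0%Z.
Proof.
assert (Hpos : forall m, (0 < m)%Z -> zpow m <> one).
{ intros m Hm. unfold zpow. replace (Z.to_nat (- m)) with 0%nat by lia. cbn.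
  rewrite (gmul1r _ _ _ Hg). apply Hinf. lia. }
intros Hn. destruct (Z.lt_trichotomy n 0) as [Hlt|[Heq|Hgt]]; [|exact Heq|].
- exfalso. apply (Hpos (- n)%Z); [lia|]. rewrite zpow_opp, Hn.
  symmetry. apply (ginv_unique _ _ _ Hg), (gmul1l _ _ _ Hg).
- exfalso. now apply (Hpos n).
Qed.

Lemma zpow_inj m n : zpow m = zpow n -> m = n.
Proof.
intros E. assert (m + - n = 0)%Z; [|lia]. apply zpow_eq_one.
now rewrite zpow_add, zpow_opp, E, (gmulVr _ _ _ Hg).
Qed.

End Powers.

(** * The axis of the constricting element and its position relative to cosets of [H] *)

Section Axis.
Context {G X : Type} (mul : G -> G -> G) (one : G) (inv : G -> G).
Context (d : X -> X -> R) (act : G -> X -> X) (Gam : path X -> Prop) (mu nu : R).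
Context (Hmu : 1 <= mu) (Hnu : 0 <= nu).
Context (HGX : path_system_group mul one inv d act Gam mu nu).

Let Hg : is_group mul one inv. Proof. apply HGX. Qed.
Let Hd : is_metric d. Proof. apply HGX. Qed.
Let HG : path_system d mu nu Gam. Proof. apply HGX. Qed.
Let Hi : invariant_paths act Gam. Proof. apply HGX. Qed.
Let aM := actM mul one inv d act Gam mu nu HGX.
Let adist := act_dist mul one inv d act Gam mu nu HGX.
Let adistV := act_dist_inv mul one inv d act Gam mu nu HGX.
Let aK := actK mul one inv d act Gam mu nu HGX.

Context (g : G) (Hinf : forall n : nat, (1 <= n)%nat -> gpow mul one g n <> one).
Let zp := zpow mul one inv g.

(** The powers with exponents [m * i] are pairwise distinct, and by properness only finitely many
    elements move [x] by at most [r]. *)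
Lemma zpow_unbounded m x r : m <> 0%Z -> exists n, r < d x (act (zp (m * n)) x).
Proof.
intros Hm. apply NNPP. intros Hno.
destruct (act_finite mul one inv d act Gam mu nu HGX x x r) as [B HB].
assert (Hnd : NoDup (map (fun i => zp (m * Z.of_nat i)) (seq 0 (S (length B))))).
{ apply Injective_map_NoDup; [|apply seq_NoDup]. intros i j Hij.
  apply (zpow_inj _ _ _ Hg _ Hinf) in Hij. nia. }
apply NoDup_incl_length with (l' := B) in Hnd.
- rewrite length_map, length_seq in Hnd. lia.
- intros b Hb. apply in_map_iff in Hb as (i & <- & _). apply HB.
  apply Rnot_lt_le. intros Hlt. apply Hno. now exists (Z.of_nat i).
Qed.

Context (delta : R) (Hdelta : 0 <= delta) (A : X -> Prop) (P : X -> X).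
Context (HAinv : forall k x, in_cyclic mul one inv g k -> A x -> A (act k x)).
Context (HPA : forall x, A (P x)) (HAP : forall x, A x -> d x (P x) <= delta).
Context (HP : constricting_map d Gam delta P).
Context (HAcob : forall a a', A a -> A a' ->
  exists k, in_cyclic mul one inv g k /\ d a (act k a') <= delta).

Let K0 := 4 * delta + mu * delta + nu.

(** The conjugate of [P] by a power of [g] is again a constricting projection onto the invariant set
    [A], and two such projections are uniformly close. *)
Lemma coarsely_equivariant n x : d (P (act (zp n) x)) (act (zp n) (P x)) <= K0.
Proof.
assert (HA : forall y, A (act (zp n) (P y))).
{ intros y. apply HAinv; [|apply HPA]. apply (in_cyclic_zpow _ _ _ Hg). now exists n. }
assert (HA' : forall y, A (act (inv (zp n)) (P y))).
{ intros y. apply HAinv; [|apply HPA]. apply (in_cyclic_zpow _ _ _ Hg). exists (- n)%Z.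
  symmetry. apply (zpow_opp _ _ _ Hg). }
pose (Q := fun y => act (inv (zp n)) (P (act (zp n) y))).
assert (HQ : constricting_map d Gam delta Q).
{ assert (HQ0 := constricting_map_conj mul one inv d act Gam mu nu HGX delta P (inv (zp n)) HP).
  rewrite (ginvK _ _ _ Hg) in HQ0. exact HQ0. }
rewrite (metric_sym d Hd), adistV.
apply (constricting_maps_close d Gam mu nu Hmu Hnu Hd HG delta P Q x Hdelta HP HQ).
- intros y. rewrite (metric_sym d Hd). apply HAP, HA'.
- intros y. unfold Q. rewrite adistV, (ginvK _ _ _ Hg), (metric_sym d Hd). apply HAP, HA.
Qed.

Lemma cyclic_orbit_near x a : A x -> A a -> exists n, d x (act (zp n) a) <= delta.
Proof.
intros Hx Ha'. destruct (HAcob x a Hx Ha') as (k & Hk & Hxk).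
apply (in_cyclic_zpow _ _ _ Hg) in Hk as [n ->]. now exists n.
Qed.

Context (H : G -> Prop) (HH : is_subgroup mul one inv H).
Context (eta : R) (Y : X -> Prop) (y0 : X) (Hy0 : Y y0).
Context (HYinv : forall h y, H h -> Y y -> Y (act h y)).
Context (HYqc : quasi_convex_set d Gam eta Y).
Context (HYcob : forall y y', Y y -> Y y' -> exists h, H h /\ d y (act h y') <= eta).

Let a0 := P y0.

(** Translated by [inv k], the path has its endpoints in [Y]. Quasi-convexity and coboundedness cost
    [eta] each; the extra 1 is the slack of a distance to [Y] that need not be attained. *)
Lemma path_near_orbit k h h' p t : H h -> H h' -> Gam p -> p_a p <= t <= p_b p ->
  p_f p (p_a p) = act (mul k h) y0 -> p_f p (p_b p) = act (mul k h') y0 ->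
  exists h'', H h'' /\ d (p_f p t) (act (mul k h'') y0) <= 2 * eta + 1.
Proof.
intros Hh Hh' Hp Ht Hpa Hpb.
assert (HYe := HYqc _ (Hi (inv k) _ Hp)). cbn in HYe.
rewrite Hpa, Hpb, !aM, !aK in HYe.
destruct (HYe (HYinv _ _ Hh Hy0) (HYinv _ _ Hh' Hy0) t Ht 1 Rlt_0_1) as (y & Hy & Hty).
destruct (HYcob y y0 Hy Hy0) as (h'' & Hh'' & Hyh).
exists h''. split; [exact Hh''|]. rewrite aM.
rewrite adistV, (ginvK _ _ _ Hg) in Hty.
assert (T := metric_triangle d Hd (p_f p t) (act k y) (act k (act h'' y0))).
rewrite adist in T. lra.
Qed.

Lemma conj_zpow_subgroup k m q : H (mul (inv k) (mul (zp m) k)) ->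
  H (mul (inv k) (mul (zp (m * q)) k)).
Proof.
destruct HH as (H1 & HM & HV). intros Hm.
assert (conjM : forall a b, mul (inv k) (mul (mul a b) k) =
  mul (mul (inv k) (mul a k)) (mul (inv k) (mul b k))).
{ intros a b. rewrite <- !(gmulA _ _ _ Hg), (gmulKVl _ _ _ Hg). reflexivity. }
assert (conjV : forall a, mul (inv k) (mul (inv a) k) = inv (mul (inv k) (mul a k))).
{ intros a. rewrite !(ginvM _ _ _ Hg), (ginvK _ _ _ Hg). apply (gmulA _ _ _ Hg). }
induction q as [|q IH|q IH] using Z.peano_ind.
- rewrite Z.mul_0_r. unfold zp. rewrite (zpow_0 _ _ _ Hg), (gmul1l _ _ _ Hg), (gmulVl _ _ _ Hg).
  exact H1.
- rewrite Z.mul_succ_r. unfold zp. rewrite (zpow_add _ _ _ Hg), conjM. now apply HM.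
- rewrite Z.mul_pred_r, <- Z.add_opp_r. unfold zp.
  rewrite (zpow_add _ _ _ Hg), conjM, (zpow_opp _ _ _ Hg), conjV. auto.
Qed.

(* If a conjugate of [g^m] lies in [H], then the axis is within bounded distance of [k H y0],
   as the path from [k y0] to its image under a high power of [g^m] passes near the axis. *)
Lemma axis_near_coset m : m <> 0%Z -> exists C, forall k, H (mul (inv k) (mul (zp m) k)) ->
  exists h, H h /\ d a0 (act (mul k h) y0) <= C.
Proof.
intros Hm. assert (HH' := HH). destruct HH' as (H1 & HM & HV).
assert (dtri := metric_triangle d Hd). assert (dsym := metric_sym d Hd).
(* [Cm] bounds the displacement of [a0] under the powers given by remainders modulo [m]; the range
   from [- Z.abs m] covers both signs of [m]. *)
destruct (list_uniform_bound (fun r C => d a0 (act (zp r) a0) <= C)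
  (map (fun i => (Z.of_nat i - Z.abs m)%Z) (seq 0 (2 * Z.to_nat (Z.abs m))))) as [Cm HCm].
{ intros; lra. }
{ intros x _. eexists. apply Rle_refl. }
exists (2 * delta + (2 * eta + 1) + Cm). intros k Hk.
(* After the error [K0] of coarse equivariance, the projections of the two endpoints are still more
   than [delta] apart. *)
destruct (zpow_unbounded m (P (act k y0)) (delta + K0) Hm) as [n Hn].
set (z := act k y0) in *.
destruct (path_between d Gam mu nu HG z (act (zp (m * n)) z)) as (p & Hp & Hab & Hpa & Hpb).
destruct (constricting_between d Gam mu nu Hd HG delta P HP p (p_a p) (p_b p))
  as (t & Ht & Ht'); try lra; auto.
{ rewrite Hpa, Hpb. assert (T := dtri (P z) (P (act (zp (m * n)) z)) (act (zp (m * n)) (P z))).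
  assert (T' := coarsely_equivariant (m * n) z). lra. }
rewrite Rmin_left, Rmax_right in Ht by lra. rewrite Hpa in Ht'.
assert (Hkk : forall q, act (mul (zp q) k) y0 = act (mul k (mul (inv k) (mul (zp q) k))) y0).
{ intros q. now rewrite (gmulKVl _ _ _ Hg). }
destruct (path_near_orbit k one (mul (inv k) (mul (zp (m * n)) k)) p t) as (h & Hh & Hth); auto.
{ now apply conj_zpow_subgroup. }
{ rewrite Hpa, (gmul1r _ _ _ Hg). reflexivity. }
{ rewrite Hpb, <- Hkk, aM. reflexivity. }
destruct (cyclic_orbit_near (P z) a0 (HPA _) (HPA _)) as [j Hj].
assert (Hjm := Z.div_mod j m Hm).
set (q := (j / m)%Z) in *. set (r := (j mod m)%Z) in *.
assert (Hr : (- Z.abs m <= r < Z.abs m)%Z).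
{ destruct (Z.lt_trichotomy m 0) as [Hlt|[Heq|Hgt]]; [|contradiction|].
  - assert (Hb := Z.mod_neg_bound j m Hlt). lia.
  - assert (Hb := Z.mod_pos_bound j m Hgt). lia. }
(* The power with exponent [m * - q], which lies in [k H k^-1], carries the orbit point near
   [act (zp j) a0] to one near [act (zp r) a0], with [r] the remainder of [j]. *)
exists (mul (mul (inv k) (mul (zp (m * (- q))) k)) h). split.
{ apply HM; [now apply conj_zpow_subgroup|exact Hh]. }
assert (HCr : d a0 (act (zp r) a0) <= Cm).
{ apply HCm, in_map_iff. exists (Z.to_nat (r + Z.abs m)). split; [lia|]. apply in_seq. lia. }
rewrite !(gmulA _ _ _ Hg), (gmulVr _ _ _ Hg), (gmul1l _ _ _ Hg), <- (gmulA _ _ _ Hg), aM.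
assert (Hd1 : d (act (zp j) a0) (act (mul k h) y0) <= 2 * delta + (2 * eta + 1)).
{ assert (T1 := dtri (act (zp j) a0) (P z) (act (mul k h) y0)).
  assert (T2 := dtri (P z) (p_f p t) (act (mul k h) y0)).
  rewrite (dsym _ (P z)) in T1. rewrite (dsym (P z) (p_f p t)) in T2. lra. }
rewrite <- (adist (zp (m * - q))), <- aM in Hd1. unfold zp in Hd1 at 1 2.
rewrite <- (zpow_add _ _ _ Hg) in Hd1. fold (zp (m * - q + j)) in Hd1.
replace (m * - q + j)%Z with r in Hd1 by lia.
assert (T := dtri a0 (act (zp r) a0) (act (zp (m * - q)) (act (mul k h) y0))).
fold zp in Hd1. lra.
Qed.

(* Projections of a path move in bounded steps and stay near the path, so a long projection
   yields many points of the axis near [k H y0]; two of them differ by [h] in [k H k^-1]. *)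
Lemma unbounded_projection_power : exists R1, forall k,
  (forall D, exists h, H h /\ D < d (P (act (mul k h) y0)) (P (act k y0))) ->
  exists m, m <> 0%Z /\ H (mul (inv k) (mul (zp m) k)) /\ d a0 (act (zp m) a0) <= R1.
Proof.
assert (HH' := HH). destruct HH' as (H1 & HM & HV).
assert (dtri := metric_triangle d Hd). assert (dsym := metric_sym d Hd).
(* [c1] bounds the jump of the projection in unit time. The spacing [s] is so large that points
   chosen at different levels cannot both be within [delta] of the same translate of [a0]. *)
pose (c1 := 2 * delta + mu * 1 + nu). pose (s := c1 + 2 * delta + 1).
assert (Hc1 : 0 <= c1) by (unfold c1; lra).
assert (Hs : 0 <= s) by (unfold s; lra).
pose (Ca := 2 * delta + (2 * eta + 1)).
destruct (act_finite mul one inv d act Gam mu nu HGX a0 y0 (Ca + delta)) as [B HB].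
pose (M := length B).
exists (2 * delta + 2 * (INR M * s + c1)). intros k Hk.
destruct (Hk (INR M * s + delta)) as (h & Hh & Hfar).
assert (HMs : forall i, (i <= M)%nat -> 0 <= INR i * s <= INR M * s).
{ intros i Hi'. split.
  - apply Rmult_le_pos; [apply pos_INR|exact Hs].
  - apply Rmult_le_compat_r; [exact Hs|now apply le_INR]. }
set (z := act k y0) in *. rewrite dsym in Hfar.
destruct (path_between d Gam mu nu HG z (act (mul k h) y0)) as (p & Hp & Hab & Hpa & Hpb).
(* If [P (p_f p t)] is close to [P z], the whole path passes near [P z]; otherwise the piece from
   the start to time [t] passes near [P (p_f p t)] itself. *)
assert (Hnear : forall t, p_a p <= t <= p_b p ->
  exists h', H h' /\ d (P (p_f p t)) (act (mul k h') y0) <= Ca).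
{ intros t Ht.
  assert (Horb : forall r x, p_a p <= r <= p_b p -> d (p_f p r) x <= 2 * delta ->
    exists h', H h' /\ d x (act (mul k h') y0) <= Ca).
  { intros r x Hr Hrx. destruct (path_near_orbit k one h p r) as (h' & Hh' & Hrh); auto.
    { now rewrite (gmul1r _ _ _ Hg). }
    exists h'. split; [exact Hh'|]. assert (T := dtri x (p_f p r) (act (mul k h') y0)).
    rewrite (dsym x (p_f p r)) in T. unfold Ca. lra. }
  destruct (Rle_dec (d (P z) (P (p_f p t))) delta) as [Hle|Hgt].
  - destruct (constricting_between d Gam mu nu Hd HG delta P HP p (p_a p) (p_b p))
      as (r & Hr & Hr'); try lra; auto.
    { rewrite Hpa, Hpb. specialize (HMs M (le_n M)). lra. }
    rewrite Rmin_left, Rmax_right in Hr by lra. rewrite Hpa in Hr'.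
    apply (Horb r); [lra|]. assert (T := dtri (p_f p r) (P z) (P (p_f p t))). lra.
  - destruct (constricting_between d Gam mu nu Hd HG delta P HP p t (p_a p))
      as (r & Hr & Hr'); try lra; auto.
    { rewrite Hpa, dsym. lra. }
    rewrite Rmin_right, Rmax_left in Hr by lra. apply (Horb r); lra. }
(* A discrete intermediate value argument, as [P] need not be continuous: going back in unit steps,
   the distance to [P z] cannot jump over an interval of length [c1]. *)
assert (Hivt : forall r, 0 <= r -> forall n t, p_a p <= t <= p_b p -> t <= p_a p + INR n ->
  r < d (P z) (P (p_f p t)) ->
  exists t', p_a p <= t' <= p_b p /\ r <= d (P z) (P (p_f p t')) <= r + c1).
{ intros r Hr. induction n as [|n IH]; intros t Ht Htn Hrt.
  - cbn in Htn. replace t with (p_a p) in Hrt by lra.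
    rewrite Hpa, (metric_refl d Hd) in Hrt. lra.
  - rewrite S_INR in Htn.
    destruct (Rle_dec (d (P z) (P (p_f p t))) (r + c1)) as [Hle|Hgt]; [exists t; lra|].
    pose (t' := Rmax (p_a p) (t - 1)).
    assert (Ht' : p_a p <= t' /\ t - 1 <= t' /\ t' <= t /\ t' <= p_a p + INR n).
    { assert (Hn := pos_INR n). unfold t', Rmax. destruct (Rle_dec (p_a p) (t - 1)); lra. }
    apply (IH t'); try lra.
    assert (HL := path_dist_le d Gam mu nu HG p t' t Hp ltac:(lra) Ht).
    rewrite Rabs_minus_sym, Rabs_pos_eq in HL by lra.
    assert (HL1 := constricting_lipschitz d Gam mu nu Hmu Hnu Hd HG delta P Hdelta HP
                     (p_f p t') (p_f p t) 1 ltac:(lra)).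
    fold c1 in HL1. assert (T := dtri (P z) (P (p_f p t')) (P (p_f p t))). lra. }
(* A point [q] at level [i], near [act (zp n) a0] and near [act (mul k h') y0], is recorded by the
   element [b], which moves [y0] near [a0] and so lies in [B], a list independent of [k]. If levels
   [i] and [j] share [b], the power with exponent [nj - ni] equals [k hj hi^-1 k^-1]. *)
pose (Rel := fun (i : nat) (b : G) => exists q n h', H h' /\ b = mul (zp (- n)) (mul k h') /\
  INR i * s <= d (P z) q <= INR i * s + c1 /\ d q (act (zp n) a0) <= delta).
destruct (relational_pigeonhole Rel B) as (i & j & b & Hij & Hi' & Hj').
{ intros i Hi'. fold M in Hi'. specialize (HMs i Hi').
  destruct (INR_unbounded (p_b p - p_a p)) as [n Hn].
  destruct (Hivt (INR i * s) ltac:(lra) n (p_b p)) as (t & Ht & Hti); try lra.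
  { rewrite Hpb. lra. }
  destruct (Hnear t Ht) as (h' & Hh' & Hth).
  destruct (cyclic_orbit_near (P (p_f p t)) a0 (HPA _) (HPA _)) as [q Hq].
  exists (mul (zp (- q)) (mul k h')). split.
  - apply HB. unfold zp. rewrite aM, (zpow_opp _ _ _ Hg), <- adistV. fold zp.
    assert (T := dtri (act (zp q) a0) (P (p_f p t)) (act (mul k h') y0)).
    rewrite (dsym (act (zp q) a0) (P (p_f p t))) in T. unfold zp in *. lra.
  - exists (P (p_f p t)), q, h'. repeat split; try tauto; lra. }
destruct Hi' as (qi & ni & hi & Hhi & Hbi & Hqi & Hni).
destruct Hj' as (qj & nj & hj & Hhj & Hbj & Hqj & Hnj).
fold M in Hij.
assert (Hsi := HMs i ltac:(lia)). assert (Hsj := HMs j ltac:(lia)).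
assert (Hsij : INR i * s + s <= INR j * s).
{ replace (INR i * s + s) with (INR (S i) * s) by (rewrite S_INR; ring).
  apply Rmult_le_compat_r; [exact Hs|]. apply le_INR. lia. }
exists (nj - ni)%Z. split; [|split].
- intros Hm. replace nj with ni in Hnj by lia.
  assert (T1 := dtri (P z) qi qj). assert (T2 := dtri qi (act (zp ni) a0) qj).
  rewrite (dsym (act (zp ni) a0) qj) in T2. assert (Es : s = c1 + 2 * delta + 1) by reflexivity. clearbody s. lra.
- replace (mul (inv k) (mul (zp (nj - ni)) k)) with (mul hj (inv hi)); [auto|].
  assert (E : mul (zp (nj - ni)) (mul k hi) = mul k hj).
  { rewrite <- Z.add_opp_r. unfold zp in *.
    rewrite (zpow_add _ _ _ Hg), <- (gmulA _ _ _ Hg), <- Hbi, Hbj, (zpow_opp _ _ _ Hg).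
    apply (gmulKVl _ _ _ Hg). }
  rewrite <- (gmulKl _ _ _ Hg k hj), <- E, <- !(gmulA _ _ _ Hg).
  now rewrite (gmulVr _ _ _ Hg), (gmul1r _ _ _ Hg).
- assert (E : d a0 (act (zp (nj - ni)) a0) = d (act (zp ni) a0) (act (zp nj) a0)).
  { replace nj with (ni + (nj - ni))%Z at 2 by lia. unfold zp.
    now rewrite (zpow_add _ _ _ Hg), aM, adist. }
  rewrite E. assert (T1 := dtri (act (zp ni) a0) qi (act (zp nj) a0)).
  assert (T2 := dtri qi qj (act (zp nj) a0)). assert (T3 := dtri qi (P z) qj).
  rewrite (dsym (act (zp ni) a0) qi) in T1. rewrite (dsym qi (P z)) in T3. lra.
Qed.

Context (Hidx : infinite_index mul inv H).

(** Otherwise every coset [k H] has a representative moving [y0] within a uniform distance of [a0],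
    and properness leaves only finitely many such representatives. *)
Lemma bounded_projection_translate : exists k D, forall h, H h ->
  d (P (act (mul k h) y0)) (P (act k y0)) <= D.
Proof.
apply NNPP. intros Hno.
assert (Hunb : forall k D, exists h, H h /\ D < d (P (act (mul k h) y0)) (P (act k y0))).
{ intros k D. apply NNPP. intros Hk. apply Hno. exists k, D. intros h Hh.
  apply Rnot_lt_le. intros Hlt. apply Hk. now exists h. }
destruct unbounded_projection_power as [R1 HR1].
destruct (act_finite mul one inv d act Gam mu nu HGX a0 a0 R1) as [B HB].
destruct (list_uniform_bound (fun b C => forall m k, b = zp m -> m <> 0%Z ->
  H (mul (inv k) (mul (zp m) k)) -> exists h, H h /\ d a0 (act (mul k h) y0) <= C) B)
  as [C HC].
{ intros b C C' HbC HCC m k Hbm Hm Hk. destruct (HbC m k Hbm Hm Hk) as (h & Hh & Hd').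
  exists h. split; [exact Hh|lra]. }
(* The exponent is determined by [b] because [g] has infinite order; for an element that is no
   nonzero power the bound holds vacuously. *)
{ intros b _. destruct (classic (exists m, b = zp m /\ m <> 0%Z)) as [(m & -> & Hm)|Hb].
  - destruct (axis_near_coset m Hm) as [C HC]. exists C. intros m' k Hmm Hm'.
    apply (zpow_inj _ _ _ Hg _ Hinf) in Hmm as <-. apply HC.
  - exists 0. intros m k Hbm Hm. exfalso. apply Hb. now exists m. }
destruct (act_finite mul one inv d act Gam mu nu HGX a0 y0 C) as [B' HB'].
apply Hidx. exists B'. intros k.
destruct (HR1 k (Hunb k)) as (m & Hm & Hk & Hmd).
destruct (HC (zp m) (HB _ Hmd) m k eq_refl Hm Hk) as (h & Hh & Hkh).
exists (mul k h). split; [now apply HB'|].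
rewrite (ginvM _ _ _ Hg), <- (gmulA _ _ _ Hg), (gmulVl _ _ _ Hg), (gmul1r _ _ _ Hg).
now apply HH.
Qed.

End Axis.

(** * Exponentially weighted finite sums and greedy thinning *)

Lemma exp_le x y : x <= y -> exp x <= exp y.
Proof. intros [Hlt| ->]; [left; now apply exp_increasing|right; reflexivity]. Qed.

Section Sums.
Context {T : Type}.
Implicit Types (f w : T -> R) (l : list T).

Lemma sum_list_app (l1 l2 : list R) : sum_list (l1 ++ l2) = sum_list l1 + sum_list l2.
Proof. induction l1 as [|x l1 IH]; cbn; [ring|rewrite IH; ring]. Qed.

Lemma sum_list_scal c f l : sum_list (map (fun x => c * f x) l) = c * sum_list (map f l).
Proof. induction l as [|x l IH]; cbn; [ring|rewrite IH; ring]. Qed.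

Lemma sum_list_le f g l : (forall x, In x l -> f x <= g x) ->
  sum_list (map f l) <= sum_list (map g l).
Proof.
induction l as [|x l IH]; intros Hl; cbn; [lra|].
assert (f x <= g x) by (apply Hl; now left).
assert (sum_list (map f l) <= sum_list (map g l)) by (apply IH; intros; apply Hl; now right).
lra.
Qed.

Lemma sum_list_le_length f c l : (forall x, In x l -> f x <= c) ->
  sum_list (map f l) <= INR (length l) * c.
Proof.
induction l as [|x l IH]; intros Hl; [cbn; lra|].
cbn [map sum_list length]. rewrite S_INR.
assert (f x <= c) by (apply Hl; now left).
assert (sum_list (map f l) <= INR (length l) * c) by (apply IH; intros; apply Hl; now right).
lra.
Qed.

Lemma sum_list_filter (b : T -> bool) f l : sum_list (map f l) =
  sum_list (map f (filter b l)) + sum_list (map f (filter (fun x => negb (b x)) l)).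
Proof.
induction l as [|x l IH]; cbn; [ring|]. destruct (b x); cbn; rewrite IH; ring.
Qed.

(** The shell where [f] lies between [K] and [K + 1] has at most [C * exp (s * (K + 1))] elements,
    each of weight at most [exp (- s * K)], so every shell contributes at most [C * exp s]. *)
Lemma weighted_sum_linear f s C : 0 <= s ->
  (forall k l, NoDup l -> (forall x, In x l -> f x <= INR k) ->
    INR (length l) <= C * exp (s * INR k)) ->
  (forall x, 0 <= f x) ->
  forall K l, NoDup l -> (forall x, In x l -> f x <= INR K) ->
  sum_list (map (fun x => exp (- s * f x)) l) <= (INR K + 1) * (C * exp s).
Proof.
intros Hs Hcount Hf. induction K as [|K IH]; intros l Hnd Hl.
- cbn [INR]. assert (Hc := Hcount 0%nat l Hnd Hl). cbn [INR] in Hc.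
  rewrite Rmult_0_r, exp_0 in Hc.
  assert (H0 := pos_INR (length l)). assert (H1 := exp_ineq1_le s).
  assert (C * 1 <= C * exp s) by (apply Rmult_le_compat_l; lra).
  apply Rle_trans with (INR (length l) * 1); [|lra]. apply sum_list_le_length.
  intros x Hx. rewrite <- exp_0. apply exp_le. specialize (Hf x). nra.
- rewrite S_INR, (sum_list_filter (fun x => if Rle_dec (f x) (INR K) then true else false)).
  set (l1 := filter _ l). set (l2 := filter _ l).
  assert (H1 : sum_list (map (fun x => exp (- s * f x)) l1) <= (INR K + 1) * (C * exp s)).
  { apply IH; [now apply NoDup_filter|]. intros x Hx. apply filter_In in Hx as [_ Hx].
    destruct (Rle_dec (f x) (INR K)); [assumption|discriminate]. }
  assert (H2 : sum_list (map (fun x => exp (- s * f x)) l2) <=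
                INR (length l2) * exp (- s * INR K)).
  { apply sum_list_le_length. intros x Hx. apply filter_In in Hx as [_ Hx].
    destruct (Rle_dec (f x) (INR K)); [discriminate|]. apply exp_le. nra. }
  assert (H3 : INR (length l2) <= C * exp (s * INR (S K))).
  { apply Hcount; [now apply NoDup_filter|]. intros x Hx. apply Hl. now apply filter_In in Hx. }
  apply (Rmult_le_compat_r (exp (- s * INR K))) in H3; [|left; apply exp_pos].
  rewrite Rmult_assoc, <- exp_plus, S_INR in H3.
  replace (s * (INR K + 1) + - s * INR K) with s in H3 by ring. lra.
Qed.

(** Greedy choice: keep the head [a] and discard all elements within [c] of it, whose weight
    together with that of [a] is at most [K * w a]. The remaining list is a filtered one, hence the
    induction on a bound for the length. *)
Lemma separated_subfamily w (D : T -> T -> R) c K :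
  (forall x y, D x y = D y x) ->
  (forall x l, NoDup l -> (forall y, In y l -> D x y <= c) -> sum_list (map w l) <= K * w x) ->
  (forall x, D x x <= c) ->
  forall n l, (length l <= n)%nat -> NoDup l -> exists F, incl F l /\ NoDup F /\
    (forall x y, In x F -> In y F -> x <> y -> c < D x y) /\
    sum_list (map w l) <= K * sum_list (map w F).
Proof.
intros Dsym Hnear Drefl. induction n as [|n IH]; intros [|a l] Hlen Hnd; cbn in Hlen; try lia;
  try (exists []; cbn; split; [easy|split; [exact Hnd|split; [easy|lra]]]).
inversion_clear Hnd as [|? ? Hal Hnd'].
set (b := fun x => if Rle_dec (D a x) c then true else false).
destruct (IH (filter (fun x => negb (b x)) l)) as (F & HFl & HFnd & HFsep & HFsum).
{ assert (Hfl := filter_length b l). lia. }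
{ now apply NoDup_filter. }
assert (HFfar : forall x, In x F -> In x l /\ c < D a x).
{ intros x Hx. apply HFl, filter_In in Hx as [Hx Hbx]. split; [exact Hx|].
  unfold b in Hbx. destruct (Rle_dec (D a x) c); [discriminate|lra]. }
exists (a :: F). split; [|split; [|split]].
- intros x [<-|Hx]; [now left|right; now apply HFfar].
- constructor; [|exact HFnd]. intros Ha. now apply Hal, HFfar.
- intros x y [<-|Hx] [<-|Hy] Hne.
  + contradiction.
  + now apply HFfar.
  + rewrite Dsym. now apply HFfar.
  + now apply HFsep.
- cbn [map sum_list]. rewrite (sum_list_filter b w l).
  assert (Hs := Hnear a (a :: filter b l)). cbn [map sum_list] in Hs.
  assert (Hs' : w a + sum_list (map w (filter b l)) <= K * w a); [|lra].
  apply Hs.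
  + constructor; [|now apply NoDup_filter]. intros Ha.
    apply filter_In in Ha as [Ha _]. contradiction.
  + intros y [<-|Hy]; [apply Drefl|]. apply filter_In in Hy as [_ Hy].
    unfold b in Hy. destruct (Rle_dec (D a y) c); [assumption|discriminate].
Qed.

End Sums.

(** * Words of fixed length over a finite alphabet *)

Section Lists.
Context {T : Type}.
Implicit Types (f : T -> R) (F l : list T).

Fixpoint lists_over (F : list T) (n : nat) : list (list T) :=
  match n with
  | O => [[]]
  | S n' => flat_map (fun x => map (cons x) (lists_over F n')) F
  end.

Lemma in_lists_over F n l : In l (lists_over F n) ->
  length l = n /\ List.Forall (fun x => In x F) l.
Proof.
revert l. induction n as [|n IH]; intros l Hl; cbn in Hl.
- destruct Hl as [<-|[]]. now split; [|constructor].
- apply in_flat_map in Hl as (x & Hx & Hl). apply in_map_iff in Hl as (l' & <- & Hl').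
  destruct (IH l' Hl') as [H1 H2]. split; [cbn; now rewrite H1|now constructor].
Qed.

Lemma NoDup_lists_over F n : NoDup F -> NoDup (lists_over F n).
Proof.
intros HF. induction n as [|n IH]; cbn; [repeat constructor; easy|].
set (L := lists_over F n) in *. clearbody L.
induction HF as [|x F Hx HF IHF]; cbn; [constructor|].
apply NoDup_app; [|exact IHF|].
- apply Injective_map_NoDup; [|exact IH]. now intros ? ? [= ->].
- intros l Hl Hl'. apply in_map_iff in Hl as (l1 & <- & _).
  apply in_flat_map in Hl' as (y & Hy & Hl'). apply in_map_iff in Hl' as (l2 & [= -> _] & _).
  contradiction.
Qed.

(** The weight of a list is the product of the weights of its letters, so expanding the [n]-th power
    gives one term for each list. *)
Lemma sum_lists_over F f s n :
  sum_list (map (fun l => exp (- s * sum_list (map f l))) (lists_over F n)) =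
  sum_list (map (fun x => exp (- s * f x)) F) ^ n.
Proof.
induction n as [|n IH]; [cbn; rewrite Rmult_0_r, exp_0; ring|].
cbn [lists_over pow]. rewrite <- IH. set (L := lists_over F n).
clear IH. clearbody L. induction F as [|x F IHF]; cbn; [ring|].
rewrite map_app, sum_list_app, IHF, map_map, Rmult_plus_distr_r. f_equal.
rewrite <- sum_list_scal. f_equal. apply map_ext. intros l. cbn.
rewrite <- exp_plus. f_equal. ring.
Qed.

End Lists.

Lemma exponential_beats_linear C M : exists n, (INR (n * M) + 1) * C < 2 ^ n.
Proof.
destruct (INR_unbounded ((2 * INR M + 1) * Rabs C)) as [m Hm].
(* Since [2 ^ (2 * m)] is the square of [2 ^ m], Bernoulli's inequality makes it at least
   [(1 + m) ^ 2], which is quadratic in [m]. *)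
exists (2 * m)%nat. rewrite pow_mult, !mult_INR. replace (2 ^ 2) with ((1 + 1) ^ 2) by ring.
rewrite <- pow_mult, Nat.mul_comm, pow_mult.
assert (H1 := Rle_pow_lin 1 m Rle_0_1). assert (H0 := pos_INR m). assert (HM := pos_INR M).
assert (H2 : (1 + INR m * 1) ^ 2 <= ((1 + 1) ^ m) ^ 2) by (apply pow_incr; lra).
eapply Rlt_le_trans; [|exact H2]. clear H1 H2. cbn [INR].
assert (HC := Rle_abs C). assert (HC' := Rabs_pos C).
apply Rle_lt_trans with ((2 * INR m * INR M + 1) * Rabs C).
- replace (1 + 1) with 2 by ring. apply Rmult_le_compat_l; [|exact HC]. nra.
- apply Rle_lt_trans with ((INR m + 1) * ((2 * INR M + 1) * Rabs C)); nra.
Qed.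

Lemma finite_pred_list {T : Type} (Q : T -> Prop) : finite_pred Q ->
  exists l, NoDup l /\ forall x, In x l <-> Q x.
Proof.
intros [l Hl].
assert (Hl' : exists l', NoDup l' /\ forall x, In x l' <-> In x l /\ Q x).
{ clear Hl. induction l as [|a l (l' & Hnd & Hl')].
  - exists []. split; [constructor|]. cbn. tauto.
  - destruct (classic (Q a /\ ~ In a l)) as [[Ha Hal]|Hno].
    + exists (a :: l'). split; [constructor; [|exact Hnd]; rewrite Hl'; tauto|].
      intros x. cbn. rewrite Hl'. split; [intros [<-|]; tauto|tauto].
    + exists l'. split; [exact Hnd|]. intros x. rewrite Hl'. cbn.
      split; [tauto|]. intros [[<-|Hx] HQ]; [|tauto]. split; [|exact HQ].
      apply NNPP. tauto. }
destruct Hl' as (l' & Hnd & Hl'). exists l'. split; [exact Hnd|].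
intros x. rewrite Hl'. firstorder.
Qed.

(** * Growth rates, the Poincaré series and free families *)

Section Growth.
Context {G X : Type} (mul : G -> G -> G) (one : G) (inv : G -> G).
Context (d : X -> X -> R) (act : G -> X -> X) (Gam : path X -> Prop) (mu nu : R).
Context (HGX : path_system_group mul one inv d act Gam mu nu).
Context (o : X).

Let Hg : is_group mul one inv. Proof. apply HGX. Qed.
Let Hd : is_metric d. Proof. apply HGX. Qed.
Let aM := actM mul one inv d act Gam mu nu HGX.
Let a1 := act1 mul one inv d act Gam mu nu HGX.
Let adist := act_dist mul one inv d act Gam mu nu HGX.

Lemma ball_card (H : G -> Prop) r :
  exists l, NoDup l /\ (forall g, In g l <-> H g /\ d o (act g o) <= r).
Proof.
apply finite_pred_list. destruct (act_finite mul one inv d act Gam mu nu HGX o o r) as [l Hl].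
exists l. intros g [_ Hgr]. now apply Hl.
Qed.

(** Each supremum in the definition dominates a value sampled beyond its [R0], so [s] is a lower
    bound of the family whose infimum is taken. *)
Lemma growth_rate_ge (H : G -> Prop) s :
  (forall R0, exists r n, R0 <= r /\ 0 < r /\
     card_is (fun g => H g /\ d o (act g o) <= r) n /\ s <= ln (INR n) / r) ->
  Rbar_le (Finite s) (growth_rate d act o H).
Proof.
intros Hs. unfold growth_rate, Rbar_glb.
destruct (Rbar_ex_glb _) as [z [Hz0 Hz]]. cbn [proj1_sig]. apply Hz.
intros x [R0 ->]. unfold Rbar_lub.
destruct (Rbar_ex_lub _) as [y [Hy Hy0]]. cbn [proj1_sig].
destruct (Hs R0) as (r & n & Hr & Hr0 & Hn & Hsn).
apply Rbar_le_trans with (Finite (ln (INR n) / r)); [exact Hsn|].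
apply Hy. now exists r, n.
Qed.

(** The identity lies in every ball of nonnegative radius, so the logarithms are nonnegative at
    large radii. This excludes the value minus infinity. *)
Lemma growth_rate_nonneg (H : G -> Prop) : H one -> Rbar_le (Finite 0) (growth_rate d act o H).
Proof.
intros H1. apply growth_rate_ge. intros R0.
destruct (ball_card H (Rmax R0 1)) as (l & Hnd & Hl).
exists (Rmax R0 1), (length l).
assert (Hr1 := Rmax_l R0 1). assert (Hr2 := Rmax_r R0 1).
split; [lra|split; [lra|split]]; [now exists l|].
assert (Hone : In one l).
{ apply Hl. split; [exact H1|]. rewrite a1, (metric_refl d Hd). lra. }
assert (Hlen : 1 <= INR (length l)).
{ change 1 with (INR 1). apply le_INR. destruct l; [easy|cbn; lia]. }
apply Rdiv_le_0_compat; [|lra]. rewrite <- ln_1. apply ln_le; lra.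
Qed.

(** If the growth bound failed, balls of large radius would have fewer than [exp (s * r)] elements,
    and the weight of the words of length [n] would be at most linear in [n]. Freeness makes these
    words distinct, with total weight at least [2 ^ n]. *)
Lemma free_family_growth (F : list G) u s :
  NoDup F -> 0 <= s ->
  (forall l l', List.Forall (fun h => In h F) l -> List.Forall (fun h => In h F) l' ->
    length l = length l' -> word mul one u l = word mul one u l' -> l = l') ->
  2 <= sum_list (map (fun h => exp (- s * (d o (act h o) + d o (act u o)))) F) ->
  Rbar_le (Finite s) (growth_rate d act o (fun _ => True)).
Proof.
intros HF Hs Hfree Hsum. apply growth_rate_ge. intros R0. apply NNPP. intros Hno.
assert (dtri := metric_triangle d Hd). assert (dnn := metric_nonneg d Hd).
set (f := fun g => d o (act g o)).
(* Shifting by [c] makes every radius [INR k + c] positive and at least [R0]; the price is the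
   constant factor [exp (s * c)]. *)
set (c := Rmax R0 1). assert (Hc1 : R0 <= c) by apply Rmax_l. assert (Hc2 : 1 <= c) by apply Rmax_r.
assert (Hcount : forall k l, NoDup l -> (forall x, In x l -> f x <= INR k) ->
  INR (length l) <= exp (s * c) * exp (s * INR k)).
{ intros k l Hnd Hl. destruct (ball_card (fun _ => True) (INR k + c)) as (l' & Hnd' & Hl').
  assert (Hk := pos_INR k).
  apply Rle_trans with (INR (length l')).
  - apply le_INR, NoDup_incl_length; [exact Hnd|]. intros x Hx. apply Hl'.
    split; [exact I|]. specialize (Hl x Hx). unfold f in Hl. lra.
  - rewrite <- exp_plus. apply Rnot_lt_le. intros Hlt. apply Hno.
    exists (INR k + c), (length l'). split; [lra|split; [lra|split]].
    + now exists l'.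
    + apply (Rmult_le_reg_r (INR k + c)); [lra|].
      replace (ln (INR (length l')) / (INR k + c) * (INR k + c)) with (ln (INR (length l')))
        by (field; lra).
      rewrite <- (ln_exp (s * (INR k + c))). apply ln_le; [apply exp_pos|].
      left. eapply Rle_lt_trans; [|exact Hlt]. right. f_equal. ring. }
set (len := fun h => d o (act h o) + d o (act u o)) in *.
(* The displacement of [o] is subadditive, so a word weighs at least the product of the weights of
   its letters. *)
assert (Hword : forall l, f (word mul one u l) <= sum_list (map len l)).
{ induction l as [|h l IH]; cbn [word map sum_list].
  - unfold f. rewrite a1, (metric_refl d Hd). cbn. lra.
  - unfold f in *. rewrite !aM.
    assert (T1 := dtri o (act h o) (act h (act u (act (word mul one u l) o)))).
    assert (T2 := dtri o (act u o) (act u (act (word mul one u l) o))).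
    rewrite adist in T1, T2. unfold len at 1. lra. }
destruct (list_uniform_bound (fun h C => len h <= C) F) as [M0 HM0].
{ intros; lra. }
{ intros x _. eexists. apply Rle_refl. }
destruct (INR_unbounded M0) as [M HM].
destruct (exponential_beats_linear (exp (s * c) * exp s) M) as [n Hn].
set (W := map (word mul one u) (lists_over F n)).
assert (HW : NoDup W).
{ apply Injective_map_NoDup_in; [|now apply NoDup_lists_over].
  intros l l' Hl Hl'. apply in_lists_over in Hl as [Hl1 Hl2], Hl' as [Hl1' Hl2'].
  apply Hfree; congruence. }
assert (HWM : forall x, In x W -> f x <= INR (n * M)).
{ intros x Hx. apply in_map_iff in Hx as (l & <- & Hl). apply in_lists_over in Hl as [Hl1 Hl2].
  eapply Rle_trans; [apply Hword|]. rewrite <- Hl1, mult_INR. apply sum_list_le_length.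
  rewrite Forall_forall in Hl2. intros x Hx. specialize (HM0 x (Hl2 x Hx)). cbn in HM0. lra. }
assert (H1 := weighted_sum_linear f s _ Hs Hcount (fun g => dnn _ _) (n * M) W HW HWM).
assert (H2 : 2 ^ n <= sum_list (map (fun x => exp (- s * f x)) W)).
{ apply Rle_trans with (sum_list (map (fun x => exp (- s * len x)) F) ^ n).
  - apply pow_incr. split; [lra|exact Hsum].
  - rewrite <- sum_lists_over. unfold W. rewrite map_map. apply sum_list_le.
    intros l _. apply exp_le. specialize (Hword l). nra. }
lra.
Qed.

Context (H : G -> Prop) (HH : is_subgroup mul one inv H).

(** Elements whose translates of [a] are within [C1] have comparable weights, and by properness
    boundedly many are close to a given one. Thinning a heavy finite part of the series therefore
    costs only the factor [K]. *)
Lemma heavy_separated_family a C1 omega N : 0 <= C1 -> 0 <= omega ->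
  poincare_diverges d act o H omega ->
  exists F, NoDup F /\ (forall h, In h F -> H h /\ C1 < d a (act h a)) /\
    (forall h h', In h F -> In h' F -> h <> h' -> C1 < d (act h a) (act h' a)) /\
    N <= sum_list (map (fun h => exp (- omega * d o (act h o))) F).
Proof.
intros HC1 Hom Hdiv.
assert (dtri := metric_triangle d Hd). assert (dsym := metric_sym d Hd).
destruct (act_finite mul one inv d act Gam mu nu HGX a a C1) as [B HB].
pose (C3 := C1 + 2 * d o a). pose (K := (INR (length B) + 1) * exp (omega * C3)).
set (w := fun h => exp (- omega * d o (act h o))).
assert (HK : 0 < K).
{ apply Rmult_lt_0_compat; [|apply exp_pos]. assert (Hp := pos_INR (length B)). lra. }
assert (Hnear : forall x l, NoDup l -> (forall y, In y l -> d (act x a) (act y a) <= C1) ->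
  sum_list (map w l) <= K * w x).
{ intros x l Hnd Hl.
  apply Rle_trans with (INR (length l) * (exp (omega * C3) * w x)).
  - apply sum_list_le_length. intros y Hy. unfold w. rewrite <- exp_plus. apply exp_le.
    specialize (Hl y Hy). assert (T1 := dtri o (act y o) (act x o)).
    assert (T2 := dtri (act y o) (act y a) (act x o)).
    assert (T3 := dtri (act y a) (act x a) (act x o)).
    rewrite !adist, (dsym (act y a) (act x a)) in *. rewrite (dsym a o) in T3.
    assert (d o (act x o) <= d o (act y o) + C3) by (unfold C3; lra). nra.
  - unfold K. rewrite <- Rmult_assoc. apply Rmult_le_compat_r; [left; apply exp_pos|].
    apply Rmult_le_compat_r; [left; apply exp_pos|].
    apply Rle_trans with (INR (length B)); [|lra]. apply le_INR.
    rewrite <- (length_map (mul (inv x))). apply NoDup_incl_length.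
    + apply Injective_map_NoDup; [|exact Hnd]. intros y z E.
      now apply (gmul_cancel_l _ _ _ Hg) in E.
    + intros y Hy. apply in_map_iff in Hy as (z & <- & Hz). apply HB.
      rewrite aM, <- (act_dist_inv mul one inv d act Gam mu nu HGX). now apply Hl. }
(* The first summand pays for the elements that move [a] by at most [C1], the second for the loss in
   thinning. *)
destruct (Hdiv (K * w one + K * N)) as (l & Hnd & HlH & Hlsum). fold w in Hlsum.
set (b := fun h => if Rle_dec (d a (act h a)) C1 then true else false).
rewrite (sum_list_filter b) in Hlsum.
assert (Hclose : sum_list (map w (filter b l)) <= K * w one).
{ apply Hnear; [now apply NoDup_filter|]. intros y Hy. apply filter_In in Hy as [_ Hy].
  rewrite a1. unfold b in Hy. destruct (Rle_dec (d a (act y a)) C1); [assumption|discriminate]. }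
destruct (separated_subfamily w (fun x y => d (act x a) (act y a)) C1 K) with
  (l := filter (fun x => negb (b x)) l) (n := length (filter (fun x => negb (b x)) l))
  as (F & HFl & HFnd & HFsep & HFsum); auto.
{ intros x. rewrite (metric_refl d Hd). exact HC1. }
{ now apply NoDup_filter. }
exists F. split; [exact HFnd|split; [|split; [exact HFsep|]]].
- intros h Hh. apply HFl, filter_In in Hh as [Hh Hbh]. split; [now apply HlH|].
  unfold b in Hbh. destruct (Rle_dec (d a (act h a)) C1); [discriminate|lra].
- apply (Rmult_le_reg_l K); [exact HK|]. lra.
Qed.

End Growth.

(** * Raising the exponent strictly, and the growth gap *)

(** On the finite list [F] the function [f] is at most some [M >= 1], so adding [ln 2 / M] to the
    exponent at most halves each term. *)
Lemma exp_weight_perturbation {T : Type} (f : T -> R) (F : list T) omega :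
  4 <= sum_list (map (fun x => exp (- omega * f x)) F) ->
  exists s, omega < s /\ 2 <= sum_list (map (fun x => exp (- s * f x)) F).
Proof.
intros Hsum.
destruct (list_uniform_bound (fun x C => f x <= C) F) as [M0 HM0].
{ intros; lra. }
{ intros x _. eexists. apply Rle_refl. }
pose (M := Rmax M0 1). assert (HM1 : M0 <= M) by apply Rmax_l. assert (HM2 : 1 <= M) by apply Rmax_r.
assert (Hln : 0 < ln 2) by (rewrite <- ln_1; apply ln_increasing; lra).
assert (He : 0 < ln 2 / M) by (apply Rdiv_lt_0_compat; lra).
exists (omega + ln 2 / M). split; [lra|].
apply Rle_trans with (/ 2 * sum_list (map (fun x => exp (- omega * f x)) F)); [lra|].
rewrite <- sum_list_scal. apply sum_list_le. intros x Hx.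
replace (/ 2) with (exp (- ln 2)) by (rewrite exp_Ropp, exp_ln; lra).
rewrite <- exp_plus. apply exp_le. specialize (HM0 x Hx). cbn in HM0.
assert (ln 2 / M * f x <= ln 2 / M * M) by (apply Rmult_le_compat_l; lra).
replace (ln 2 / M * M) with (ln 2) in * by (field; lra). lra.
Qed.

Theorem mainTheorem1 (G X : Type) (mul : G -> G -> G) (one : G) (inv : G -> G)
  (d : X -> X -> R) (act : G -> X -> X) (Gam : path X -> Prop) (mu nu : R) (o : X)
  (H : G -> Prop) :
  1 <= mu -> 0 <= nu ->
  path_system_group mul one inv d act Gam mu nu ->
  (exists g, constricting_element mul one inv d act Gam g) ->
  is_subgroup mul one inv H ->
  infinite_index mul inv H ->
  Rbar_lt (growth_rate d act o H) p_infty ->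
  divergent d act o H ->
  quasi_convex_subgroup d act Gam H ->
  Rbar_lt (growth_rate d act o H) (growth_rate d act o (fun _ => True)).
Proof.
intros Hmu Hnu HGX (g & Hinf & delta & Hdelta & A & HAinv & (P & HPA & HAP & HP2) & HAcob)
  HH Hidx Hfin Hdiv (eta & Heta & Y & (y0 & Hy0) & HYinv & HYqc & HYcob).
assert (HP : constricting_map d Gam delta P) by (split; auto).
assert (Hg : is_group mul one inv) by apply HGX.
assert (aM := actM mul one inv d act Gam mu nu HGX).
assert (adist := act_dist mul one inv d act Gam mu nu HGX).
assert (aVK := actVK mul one inv d act Gam mu nu HGX).
destruct (bounded_projection_translate mul one inv d act Gam mu nu Hmu Hnu HGX g Hinf delta Hdelta
  A P HAinv HPA HAP HP HAcob H HH eta Y y0 Hy0 HYinv HYqc HYcob Hidx) as (k & D & HD).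
(* Conjugating the projection instead of [H] keeps the subgroup and its orbit [H y0] fixed, while
   the axis becomes its translate by [inv k]. *)
pose (Pk := fun x => act (inv k) (P (act k x))).
assert (HPk : constricting_map d Gam delta Pk).
{ assert (HPk := constricting_map_conj mul one inv d act Gam mu nu HGX delta P (inv k) HP).
  rewrite (ginvK _ _ _ Hg) in HPk. exact HPk. }
pose (K0 := 4 * delta + mu * delta + nu).
assert (HK0 : 0 <= K0).
{ assert (0 <= mu * delta) by (apply Rmult_le_pos; lra). unfold K0. lra. }
destruct (words_free mul one inv d act Gam mu nu Hmu Hnu HGX delta Pk Hdelta HPk H HH y0 D K0)
  as (C1 & R1 & HC1 & Hfree); [|exact HK0|].
{ intros h Hh. unfold Pk. rewrite adist, <- aM. now apply HD. }
destruct (zpow_unbounded mul one inv d act Gam mu nu HGX g Hinf 1 (P (act k y0)) R1)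
  as [n Hn]; [lia|].
set (t := zpow mul one inv g (1 * n)) in *.
(* A power of the conjugate of [g] by [inv k]: it coarsely commutes with [Pk], and it moves [Pk y0]
   by more than [R1]. *)
pose (u := mul (inv k) (mul t k)).
assert (Hu : forall x, act u x = act (inv k) (act t (act k x))).
{ intros x. unfold u. now rewrite !aM. }
assert (Hu1 : R1 < d (Pk y0) (act u (Pk y0))).
{ rewrite Hu. unfold Pk. now rewrite aVK, adist. }
assert (Hu2 : forall x, d (Pk (act u x)) (act u (Pk x)) <= K0).
{ intros x. unfold Pk at 1 2. rewrite !Hu, !aVK, adist.
  apply (coarsely_equivariant mul one inv d act Gam mu nu Hmu Hnu HGX g delta Hdelta A P
           HAinv HPA HAP HP). }
assert (H0 := growth_rate_nonneg mul one inv d act Gam mu nu HGX o H (proj1 HH)).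
unfold divergent in Hdiv.
(* Infinite values are excluded by the finiteness hypothesis and by nonnegativity. *)
destruct (growth_rate d act o H) as [omega| |]; try easy. cbn in H0, Hdiv.
set (c := d o (act u o)).
(* The factor [exp (omega * c)] compensates for the letter [u] that follows each [h]; of the
   remaining 4, a factor 2 may be lost in raising the exponent. *)
destruct (heavy_separated_family mul one inv d act Gam mu nu HGX o H (Pk y0) C1 omega
  (4 * exp (omega * c)) HC1 H0 Hdiv) as (F & HFnd & HFH & HFsep & HFsum).
destruct (exp_weight_perturbation (fun h => d o (act h o) + c) F omega) as (s & Hs & Hs').
{ apply Rle_trans with
    (exp (- omega * c) * sum_list (map (fun h => exp (- omega * d o (act h o))) F)).
  - apply (Rmult_le_compat_l (exp (- omega * c))) in HFsum; [|left; apply exp_pos].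
    eapply Rle_trans; [|exact HFsum]. right.
    rewrite (Rmult_comm 4), <- Rmult_assoc, <- exp_plus.
    replace (- omega * c + omega * c) with 0 by ring. rewrite exp_0. ring.
  - rewrite <- sum_list_scal. apply sum_list_le. intros h _. rewrite <- exp_plus.
    right. f_equal. ring. }
apply Rbar_lt_le_trans with (Finite s); [exact Hs|].
apply (free_family_growth mul one inv d act Gam mu nu HGX o F u s HFnd); [lra| |exact Hs'].
now apply (Hfree u Hu1 Hu2 (fun h => In h F)).
Qed.
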